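(* Let $\ell$ be a field, let $E$ be a finite graph such that the Leavitt path algebra $L(E)$ over $\ell$ is simple, and let $R$ be a purely infinite simple, regular supercoherent unital $\ell$-algebra. Then $[L(E),L_2]_1=[L(E),L_2]_{M_2}\setminus\{0\}$ and $[L(E),R\otimes L_2]_1=[L(E),R\otimes L_2]_{M_2}\setminus\{0\}$ (that is, the natural map from the left hand set to the right hand set, sending the homotopy class of a unital homomorphism to its $M_2$-homotopy class, is a bijection in each case), and each of these sets has exactly one element.
   Context: Algebras are associative, not necessarily unital $\ell$-algebras; homomorphisms need not be unital; $\otimes=\otimes_\ell$. A graph $E$ is a directed graph with vertex set $E^0$, edge set $E^1$ and source and range maps $s,r:E^1\to E^0$; it is finite if $E^0$ and $E^1$ are. The Leavitt path algebra $L(E)$ is the $\ell$-algebra generated by $E^0\cup E^1\cup\{e^*:e\in E^1\}$ subject to: $vw=\delta_{v,w}v$ for $v,w\in E^0$; $s(e)e=e=er(e)$ and $r(e)e^*=e^*=e^*s(e)$; $e^*f=\delta_{e,f}r(e)$; and $v=\sum_{s(e)=v}ee^*$ for every $v$ with $0<\#s^{-1}(v)<\infty$. $L_2$ is the Leavitt path algebra of the graph with one vertex and two loops. Homomorphisms $f,g:A\to B$ are elementarily homotopic if there is a homomorphism $H:A\to B[t]$ with $\mathrm{ev}_0H=f$, $\mathrm{ev}_1H=g$; homotopy $\approx$ is the equivalence relation generated by this. With $\iota_2:B\to M_2B$ the upper left corner inclusion, $f,g$ are $M_2$-homotopic if $\iota_2f\approx\iota_2g$. $[A,B]$ and $[A,B]_{M_2}$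 are the sets of homotopy classes and of $M_2$-homotopy classes of homomorphisms $A\to B$; $0$ denotes the class of the zero homomorphism. For $A,B$ unital, $[A,B]_1\subset[A,B]$ is the set of homotopy classes of unital homomorphisms. A unital ring is purely infinite simple iff it is not a division ring and for every nonzero $x$ there are $a,b$ with $axb=1$. A unital ring is coherent if its finitely presented (right) modules form an abelian subcategory of all modules, and regular coherent if moreover every finitely presented module has finite projective dimension. $R$ is regular supercoherent if $R[t_1,\dots,t_n]$ is regular coherent for every $n\ge0$. *)

(* Defs.v *)
From HB Require Import structures.
From mathcomp Require Import all_boot all_order all_algebra.
From mathcomp Require Import generic_quotient.
From mathcomp Require Import boolp classical_sets functions.
From mathcomp Require Import mpoly.
From Stdlib Require Import Relation_Operators.

Set Implicit Arguments.
Unset Strict Implicit.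
Unset Printing Implicit Defensive.
Import GRing.Theory.
Local Open Scope ring_scope.
Local Open Scope classical_set_scope.
Local Open Scope quotient_scope.

(* Associative, not necessarily unital, K-algebras.  MathComp's [algType K] is
   unital with [1 != 0], which excludes for instance L(E) for E empty. *)
HB.mixin Record Lmodule_isNuAlgebra (K : pzRingType) A of GRing.Lmodule K A := {
  numul : A -> A -> A;
  numulA : associative numul;
  numulDl : left_distributive numul +%R;
  numulDr : right_distributive numul +%R;
  nuscaleAl : forall (k : K) (x y : A), k *: numul x y = numul (k *: x) y;
  nuscaleAr : forall (k : K) (x y : A), k *: numul x y = numul x (k *: y)
}.

#[short(type="nuAlgType")]
HB.structure Definition NuAlgebra (K : pzRingType) :=
  {A of GRing.Lmodule K A & Lmodule_isNuAlgebra K A}.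

Notation "x ** y" := (numul x y) (at level 40, left associativity).

Lemma numul0 (K : pzRingType) (A : nuAlgType K) (x : A) : x ** 0 = 0.
Proof. by have := nuscaleAr (0 : K) x 0; rewrite !scale0r. Qed.

Lemma nu0mul (K : pzRingType) (A : nuAlgType K) (x : A) : 0 ** x = 0.
Proof. by have := nuscaleAl (0 : K) 0 x; rewrite !scale0r. Qed.

Definition nu_identity (K : pzRingType) (A : nuAlgType K) (u : A) : Prop :=
  forall x, u ** x = x /\ x ** u = x.

Record two_sided_ideal (K : pzRingType) (A : nuAlgType K) (I : set A) : Prop :=
  TwoSidedIdeal {
    ideal0 : I 0;
    idealD : forall x y, I x -> I y -> I (x + y);
    idealZ : forall (k : K) x, I x -> I (k *: x);
    idealMl : forall a x, I x -> I (a ** x);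
    idealMr : forall a x, I x -> I (x ** a) }.

(* A.A <> 0 is the usual clause excluding the zero algebra and, in the absence
   of a unit, algebras with zero product. *)
Definition simple_algebra (K : pzRingType) (A : nuAlgType K) : Prop :=
  (exists x y : A, x ** y <> 0) /\
  (forall I : set A, two_sided_ideal I -> I = [set 0] \/ I = setT).

(* The (nonunital) K-algebra generated by X subject to the relations
   [rel s t], read as "s = t": terms modulo the congruence generated by the
   axioms of K-algebras and by [rel]. *)
Section Presented.
Variables (K : fieldType) (X : Type).

Inductive term : Type :=
| TGen of X
| TZero
| TAdd of term & term
| TScale of K & term
| TMul of term & term.

HB.instance Definition _ := gen_eqMixin term.
HB.instance Definition _ := gen_choiceMixin term.

Variable rel : term -> term -> Prop.

Inductive cong : term -> term -> Prop :=
| cong_rel s t : rel s t -> cong s t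
| cong_refl s : cong s s
| cong_sym s t : cong s t -> cong t s
| cong_trans s t u : cong s t -> cong t u -> cong s u
| cong_add s s' t t' : cong s s' -> cong t t' -> cong (TAdd s t) (TAdd s' t')
| cong_scale k s s' : cong s s' -> cong (TScale k s) (TScale k s')
| cong_mul s s' t t' : cong s s' -> cong t t' -> cong (TMul s t) (TMul s' t')
| cong_addA s t u : cong (TAdd s (TAdd t u)) (TAdd (TAdd s t) u)
| cong_addC s t : cong (TAdd s t) (TAdd t s)
| cong_add0 s : cong (TAdd TZero s) s
| cong_addN s : cong (TAdd (TScale (-1) s) s) TZero
| cong_scaleA a b s : cong (TScale a (TScale b s)) (TScale (a * b) s)
| cong_scale1 s : cong (TScale 1 s) s
| cong_scaleDr a s t :
    cong (TScale a (TAdd s t)) (TAdd (TScale a s) (TScale a t))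
| cong_scaleDl a b s :
    cong (TScale (a + b) s) (TAdd (TScale a s) (TScale b s))
| cong_mulA s t u : cong (TMul s (TMul t u)) (TMul (TMul s t) u)
| cong_mulDl s t u : cong (TMul (TAdd s t) u) (TAdd (TMul s u) (TMul t u))
| cong_mulDr s t u : cong (TMul s (TAdd t u)) (TAdd (TMul s t) (TMul s u))
| cong_mulZl k s t : cong (TScale k (TMul s t)) (TMul (TScale k s) t)
| cong_mulZr k s t : cong (TScale k (TMul s t)) (TMul s (TScale k t)).

Lemma congb_equiv : equiv_class_of (fun s t => `[< cong s t >]).
Proof.
split.
- by move=> s; apply/asboolP; apply: cong_refl.
- by move=> s t; apply/asboolP/asboolP; apply: cong_sym.
- move=> t s u /asboolP st /asboolP tu; apply/asboolP; exact: cong_trans st tu.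
Qed.

Definition cong_equiv : equiv_rel term := EquivRelPack congb_equiv.

Definition presented : Type := {eq_quot cong_equiv}.
HB.instance Definition _ := Choice.on presented.

Definition cls (t : term) : presented := \pi_({eq_quot cong_equiv}) t.
Definition rep (x : presented) : term := repr (x : {eq_quot cong_equiv}).
Definition gen (x : X) : presented := cls (TGen x).

Lemma repK : cancel rep cls. Proof. by move=> x; rewrite /rep /cls reprK. Qed.

Lemma clsP s t : cls s = cls t <-> cong s t.
Proof.
split=> [/eqP|st]; first by rewrite /cls eqmodE => /asboolP.
by apply/eqP; rewrite /cls eqmodE; apply/asboolP.
Qed.

Lemma cong_rep t : cong (rep (cls t)) t.
Proof. by apply/clsP; rewrite repK. Qed.

Definition padd (x y : presented) := cls (TAdd (rep x) (rep y)).
Definition pscale (k : K) (x : presented) := cls (TScale k (rep x)).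
Definition pmul (x y : presented) := cls (TMul (rep x) (rep y)).
Definition pzero := cls TZero.
Definition popp (x : presented) := pscale (-1) x.

Lemma clsD s t : padd (cls s) (cls t) = cls (TAdd s t).
Proof. by apply/clsP/cong_add; apply: cong_rep. Qed.
Lemma clsZ k s : pscale k (cls s) = cls (TScale k s).
Proof. by apply/clsP/cong_scale/cong_rep. Qed.
Lemma clsM s t : pmul (cls s) (cls t) = cls (TMul s t).
Proof. by apply/clsP/cong_mul; apply: cong_rep. Qed.

Lemma presW (P : presented -> Prop) : (forall t, P (cls t)) -> forall x, P x.
Proof. by move=> h x; rewrite -(repK x). Qed.

Lemma paddA : associative padd.
Proof.
elim/presW=> s; elim/presW=> t; elim/presW=> u.
by rewrite !clsD; apply/clsP/cong_addA.
Qed.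
Lemma paddC : commutative padd.
Proof.
by elim/presW=> s; elim/presW=> t; rewrite !clsD; apply/clsP/cong_addC.
Qed.
Lemma padd0 : left_id pzero padd.
Proof. by elim/presW=> s; rewrite clsD; apply/clsP/cong_add0. Qed.
Lemma paddN : left_inverse pzero popp padd.
Proof. by elim/presW=> s; rewrite /popp clsZ clsD; apply/clsP/cong_addN. Qed.
HB.instance Definition _ :=
  GRing.isZmodule.Build presented paddA paddC padd0 paddN.

Lemma pscaleA a b x : pscale a (pscale b x) = pscale (a * b) x.
Proof.
by elim/presW: x => s; rewrite !clsZ; apply/clsP/cong_scaleA.
Qed.
Lemma pscale1 : left_id 1 pscale.
Proof. by elim/presW=> s; rewrite clsZ; apply/clsP/cong_scale1. Qed.
Lemma pscaleDr : right_distributive pscale +%R.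
Proof.
move=> a; elim/presW=> s; elim/presW=> t.
rewrite -[cls s + _]/(padd _ _) -[RHS]/(padd _ _) clsD !clsZ clsD.
by apply/clsP/cong_scaleDr.
Qed.
Lemma pscaleDl x : {morph pscale^~ x : a b / a + b}.
Proof.
elim/presW: x => s a b; rewrite !clsZ -[RHS]/(padd _ _) clsD.
exact/clsP/cong_scaleDl.
Qed.
HB.instance Definition _ := GRing.Zmodule_isLmodule.Build K presented
  pscaleA pscale1 pscaleDr pscaleDl.

Lemma pmulA : associative pmul.
Proof.
elim/presW=> s; elim/presW=> t; elim/presW=> u.
by rewrite !clsM; apply/clsP/cong_mulA.
Qed.
Lemma pmulDl : left_distributive pmul +%R.
Proof.
elim/presW=> s; elim/presW=> t; elim/presW=> u.
rewrite -[cls s + _]/(padd _ _) -[RHS]/(padd _ _) clsD !clsM clsD.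
by apply/clsP/cong_mulDl.
Qed.
Lemma pmulDr : right_distributive pmul +%R.
Proof.
elim/presW=> s; elim/presW=> t; elim/presW=> u.
rewrite -[cls t + _]/(padd _ _) -[RHS]/(padd _ _) clsD !clsM clsD.
by apply/clsP/cong_mulDr.
Qed.
Lemma pscaleAl (k : K) x y : k *: pmul x y = pmul (k *: x) y.
Proof.
elim/presW: x => s; elim/presW: y => t.
rewrite -[k *: cls s]/(pscale _ _) -[LHS]/(pscale _ _) clsZ !clsM clsZ.
by apply/clsP/cong_mulZl.
Qed.
Lemma pscaleAr (k : K) x y : k *: pmul x y = pmul x (k *: y).
Proof.
elim/presW: x => s; elim/presW: y => t.
rewrite -[k *: cls t]/(pscale _ _) -[LHS]/(pscale _ _) clsZ !clsM clsZ.
by apply/clsP/cong_mulZr.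
Qed.
HB.instance Definition _ := Lmodule_isNuAlgebra.Build K presented
  pmulA pmulDl pmulDr pscaleAl pscaleAr.

Lemma cls_add s t : cls (TAdd s t) = cls s + cls t.
Proof. by rewrite -clsD. Qed.
Lemma cls_scale k s : cls (TScale k s) = k *: cls s.
Proof. by rewrite -clsZ. Qed.
Lemma cls_mul s t : cls (TMul s t) = cls s ** cls t.
Proof. by rewrite -clsM. Qed.
Lemma cls_zero : cls TZero = 0. Proof. by []. Qed.

Lemma cls_sum (I : Type) (r : seq I) (P : pred I) (F : I -> term) :
  cls (\big[TAdd/TZero]_(i <- r | P i) F i) = \sum_(i <- r | P i) cls (F i).
Proof.
by apply: (big_morph cls) => [s t|]; [apply: cls_add | apply: cls_zero].
Qed.

Lemma cls_rel s t : rel s t -> cls s = cls t.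
Proof. by move=> st; apply/clsP/cong_rel. Qed.

Lemma presented_identity (u : presented) :
  (forall x, u ** gen x = gen x /\ gen x ** u = gen x) -> nu_identity u.
Proof.
move=> hu; elim/presW; elim.
- exact: hu.
- by rewrite cls_zero numul0 nu0mul.
- by move=> s [sl sr] t [tl tr]; rewrite cls_add numulDr numulDl sl sr tl tr.
- by move=> k s [sl sr]; rewrite cls_scale -nuscaleAr -nuscaleAl sl sr.
- by move=> s [sl sr] t [tl tr]; rewrite cls_mul numulA sl -numulA tr.
Qed.

End Presented.

Arguments TZero {K X}.
Arguments TGen {K X} x.

(* The vertex and edge types being finite, the condition #s^-1(v) < oo in the
   last relation of [lpa_rel] is automatic. *)
Record finite_graph : Type := FiniteGraph {
  vertex : finType;
  edge : finType;
  source : edge -> vertex;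
  target : edge -> vertex }.

Inductive lpa_gen (E : finite_graph) : Type :=
| Vtx of vertex E
| Edg of edge E
| Gho of edge E.
Arguments Vtx {E} v.
Arguments Edg {E} e.
Arguments Gho {E} e.

Section Leavitt.
Variables (K : fieldType) (E : finite_graph).

Local Notation tv v := (@TGen K (lpa_gen E) (Vtx v)).
Local Notation te e := (@TGen K (lpa_gen E) (Edg e)).
Local Notation tg e := (@TGen K (lpa_gen E) (Gho e)).

Inductive lpa_rel : term K (lpa_gen E) -> term K (lpa_gen E) -> Prop :=
| lpa_vv v w : lpa_rel (TMul (tv v) (tv w)) (if v == w then tv v else TZero)
| lpa_se e : lpa_rel (TMul (tv (source e)) (te e)) (te e)
| lpa_er e : lpa_rel (TMul (te e) (tv (target e))) (te e)
| lpa_rg e : lpa_rel (TMul (tv (target e)) (tg e)) (tg e)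
| lpa_gs e : lpa_rel (TMul (tg e) (tv (source e))) (tg e)
| lpa_ck1 e f :
    lpa_rel (TMul (tg e) (te f)) (if e == f then tv (target e) else TZero)
| lpa_ck2 v : (exists e, source e = v) ->
    lpa_rel (tv v)
            (\big[@TAdd K (lpa_gen E)/TZero]_(e | source e == v)
               TMul (te e) (tg e)).

Definition leavitt : Type := presented lpa_rel.
HB.instance Definition _ := NuAlgebra.on leavitt.

Definition lpa_one : leavitt := \sum_v gen lpa_rel (Vtx v).

Lemma nu_sumr (A : nuAlgType K) (I : finType) (F : I -> A) (x : A) :
  x ** (\sum_i F i) = \sum_i x ** F i.
Proof.
apply: (big_morph (numul x)) => [y z|]; first exact: numulDr.
exact: numul0.
Qed.
Lemma nu_suml (A : nuAlgType K) (I : finType) (F : I -> A) (x : A) :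
  (\sum_i F i) ** x = \sum_i F i ** x.
Proof.
apply: (big_morph (fun y => y ** x)) => [y z|]; first exact: numulDl.
exact: nu0mul.
Qed.

Lemma lpa_vvE v w : gen lpa_rel (Vtx v) ** gen lpa_rel (Vtx w) =
  if v == w then gen lpa_rel (Vtx v) else 0.
Proof.
by rewrite /gen -cls_mul (cls_rel (lpa_vv v w)); case: eqP.
Qed.

Lemma lpa_vl v (x : leavitt) : gen lpa_rel (Vtx v) ** x = x ->
  lpa_one ** x = x.
Proof.
move=> vx; rewrite -vx numulA; congr (_ ** _).
rewrite /lpa_one nu_suml (bigD1 v) //= lpa_vvE eqxx big1 ?addr0 // => w wv.
by rewrite lpa_vvE (negbTE wv).
Qed.

Lemma lpa_vr v (x : leavitt) : x ** gen lpa_rel (Vtx v) = x ->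
  x ** lpa_one = x.
Proof.
move=> xv; rewrite -xv -numulA; congr (_ ** _).
rewrite /lpa_one nu_sumr (bigD1 v) //= lpa_vvE eqxx big1 ?addr0 // => w wv.
by rewrite lpa_vvE eq_sym (negbTE wv).
Qed.

Lemma lpa_oneP : nu_identity lpa_one.
Proof.
apply: presented_identity => -[v|e|e]; split.
- by apply: (lpa_vl (v := v)); rewrite lpa_vvE eqxx.
- by apply: (lpa_vr (v := v)); rewrite lpa_vvE eqxx.
- by apply: (lpa_vl (v := source e)); rewrite -cls_mul; apply/cls_rel/lpa_se.
- by apply: (lpa_vr (v := target e)); rewrite -cls_mul; apply/cls_rel/lpa_er.
- by apply: (lpa_vl (v := target e)); rewrite -cls_mul; apply/cls_rel/lpa_rg.
- by apply: (lpa_vr (v := source e)); rewrite -cls_mul; apply/cls_rel/lpa_gs.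
Qed.

End Leavitt.

Definition rose2 : finite_graph := @FiniteGraph unit bool (fun=> tt) (fun=> tt).

Definition L2 (K : fieldType) : Type := leavitt K rose2.
HB.instance Definition _ K := NuAlgebra.on (L2 K).

(* L_2 acts on sequences [nat -> V], the two ghost loops extracting the even
   and the odd subsequence; this shows that [1 != 0] in L_2 and R (x) L_2. *)
Section L2Action.
Variables (K : fieldType) (V : lmodType K).

Definition gen_act (x : lpa_gen rose2) (f : nat -> V) : nat -> V :=
  match x with
  | Vtx _ => f
  | Edg b => fun n => if odd n == b then f n./2 else 0
  | Gho b => fun n => f (b + n.*2)%N
  end.

Fixpoint term_act (t : term K (lpa_gen rose2)) (f : nat -> V) : nat -> V :=
  match t with
  | TGen x => gen_act x f
  | TZero => fun=> 0
  | TAdd s t => fun n => term_act s f n + term_act t f n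
  | TScale k s => fun n => k *: term_act s f n
  | TMul s t => term_act s (term_act t f)
  end.

Lemma term_act_ext t f g : f =1 g -> term_act t f =1 term_act t g.
Proof. by move=> /funext ->. Qed.

Lemma term_actD t f g :
  term_act t (fun n => f n + g n) =1 (fun n => term_act t f n + term_act t g n).
Proof.
elim: t f g => [[v|b|b]||s IHs t IHt|k s IHs|s IHs t IHt] f g n //=.
- by case: eqP; rewrite ?addr0.
- by rewrite addr0.
- by rewrite IHs IHt addrACA.
- by rewrite IHs scalerDr.
- by rewrite (term_act_ext s (IHt f g)) IHs.
Qed.

Lemma term_actZ t k f :
  term_act t (fun n => k *: f n) =1 (fun n => k *: term_act t f n).
Proof.
elim: t f => [[v|b|b]||s IHs t IHt|l s IHs|s IHs t IHt] f n //=.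
- by case: eqP; rewrite ?scaler0.
- by rewrite scaler0.
- by rewrite IHs IHt scalerDr.
- by rewrite IHs !scalerA mulrC.
- by rewrite (term_act_ext s (IHt f)) IHs.
Qed.

Lemma term_act_sum (I : Type) (r : seq I) (P : pred I) F f n :
  term_act (\big[@TAdd K (lpa_gen rose2)/TZero]_(i <- r | P i) F i) f n =
  \sum_(i <- r | P i) term_act (F i) f n.
Proof. exact: (big_morph (fun t => term_act t f n)). Qed.

Lemma term_act_rel s t f : lpa_rel s t -> term_act s f =1 term_act t f.
Proof.
case=> [[] []|b|b|b|b|a b|[] _] n //=.
  case: a b => [] [] /=; rewrite ?oddD ?odd_double ?doubleK //=.
  by rewrite uphalf_double.
rewrite term_act_sum big_bool /=; case: (boolP (odd n)) => on /=;
  rewrite ?add0r ?addr0.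
  by congr f; rewrite -[LHS]odd_double_half on.
by congr f; rewrite -[LHS]odd_double_half (negbTE on).
Qed.

Lemma term_act_cong s t f : cong (@lpa_rel K rose2) s t ->
  term_act s f =1 term_act t f.
Proof.
move=> st; elim: st f => {s t}.
- by move=> s t st f; apply: term_act_rel.
- by [].
- by move=> s t _ IH f n; rewrite IH.
- by move=> s t u _ IH1 _ IH2 f n; rewrite IH1 IH2.
- by move=> s s' t t' _ IH1 _ IH2 f n /=; rewrite IH1 IH2.
- by move=> k s s' _ IH f n /=; rewrite IH.
- move=> s s' t t' _ IH1 _ IH2 f n /=.
  by rewrite IH1; apply: term_act_ext.
- by move=> s t u f n /=; rewrite addrA.
- by move=> s t f n /=; rewrite addrC.
- by move=> s f n /=; rewrite add0r.
- by move=> s f n /=; rewrite scaleN1r addNr.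
- by move=> a b s f n /=; rewrite scalerA.
- by move=> s f n /=; rewrite scale1r.
- by move=> a s t f n /=; rewrite scalerDr.
- by move=> a b s f n /=; rewrite scalerDl.
- by [].
- by [].
- by move=> s t u f n /=; rewrite term_actD.
- by [].
- by move=> k s t f n /=; rewrite term_actZ.
Qed.

Definition L2_act (x : L2 K) (f : nat -> V) : nat -> V := term_act (rep x) f.

Lemma L2_act_cls t f : L2_act (cls (@lpa_rel K rose2) t) f =1 term_act t f.
Proof. exact/term_act_cong/cong_rep. Qed.

Lemma L2_act1 f : L2_act (lpa_one K rose2) f =1 f.
Proof.
move=> n; rewrite /lpa_one /gen -cls_sum L2_act_cls.
by rewrite term_act_sum big_const card_unit /= addr0.
Qed.

Lemma L2_actD x y f n : L2_act (x + y) f n = L2_act x f n + L2_act y f n.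
Proof.
rewrite -[x in LHS](repK (rel := @lpa_rel K rose2)).
rewrite -[y in LHS](repK (rel := @lpa_rel K rose2)).
by rewrite -cls_add L2_act_cls.
Qed.

Lemma L2_actZ k x f n : L2_act (k *: x) f n = k *: L2_act x f n.
Proof.
rewrite -[x in LHS](repK (rel := @lpa_rel K rose2)).
by rewrite -cls_scale L2_act_cls.
Qed.

End L2Action.

Section L2Ring.
Variable K : fieldType.
Local Notation L2 := (L2 K).

Lemma L2_mul1 : left_id (lpa_one K rose2 : L2) (@numul K L2).
Proof. by move=> x; have [] := lpa_oneP (x : leavitt K rose2). Qed.
Lemma L2_mulr1 : right_id (lpa_one K rose2 : L2) (@numul K L2).
Proof. by move=> x; have [] := lpa_oneP (x : leavitt K rose2). Qed.
Lemma L2_one_neq0 : (lpa_one K rose2 : L2) != 0.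
Proof.
apply/eqP => e; have := L2_act1 (V := K^o) (fun=> 1) 0%N.
rewrite e -(scale0r (0 : L2)) L2_actZ scale0r => /esym/eqP.
by rewrite oner_eq0.
Qed.

HB.instance Definition _ := GRing.Zmodule_isNzRing.Build L2
  (@numulA K L2) L2_mul1 L2_mulr1 (@numulDl K L2) (@numulDr K L2) L2_one_neq0.
HB.instance Definition _ := GRing.Lmodule_isLalgebra.Build K L2
  (@nuscaleAl K L2).
HB.instance Definition _ := GRing.Lalgebra_isAlgebra.Build K L2
  (@nuscaleAr K L2).

End L2Ring.

(* The tensor product over K of two K-algebras, with its product
   (a (x) b)(a' (x) b') = aa' (x) bb', presented by the symbols a (x) b.  The
   product rule makes every element a sum of symbols, so the underlying vector
   space is the usual one: see [tensor_universal] below. *)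
Section Tensor.
Variables (K : fieldType) (A B : algType K).

Local Notation sym a b := (@TGen K (A * B) (a, b)).

Inductive tensor_rel : term K (A * B) -> term K (A * B) -> Prop :=
| tensor_addl a a' b : tensor_rel (sym (a + a') b) (TAdd (sym a b) (sym a' b))
| tensor_addr a b b' : tensor_rel (sym a (b + b')) (TAdd (sym a b) (sym a b'))
| tensor_scalel k a b : tensor_rel (sym (k *: a) b) (TScale k (sym a b))
| tensor_scaler k a b : tensor_rel (sym a (k *: b)) (TScale k (sym a b))
| tensor_mul a a' b b' :
    tensor_rel (TMul (sym a b) (sym a' b')) (sym (a * a') (b * b')).

Definition tensor : Type := presented tensor_rel.
HB.instance Definition _ := NuAlgebra.on tensor.

Definition tprod (a : A) (b : B) : tensor := gen tensor_rel (a, b).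

Lemma tprodDl a a' b : tprod (a + a') b = tprod a b + tprod a' b.
Proof. by rewrite /tprod /gen -cls_add; apply/cls_rel/tensor_addl. Qed.
Lemma tprodDr a b b' : tprod a (b + b') = tprod a b + tprod a b'.
Proof. by rewrite /tprod /gen -cls_add; apply/cls_rel/tensor_addr. Qed.
Lemma tprodZl k a b : tprod (k *: a) b = k *: tprod a b.
Proof. by rewrite /tprod /gen -cls_scale; apply/cls_rel/tensor_scalel. Qed.
Lemma tprodZr k a b : tprod a (k *: b) = k *: tprod a b.
Proof. by rewrite /tprod /gen -cls_scale; apply/cls_rel/tensor_scaler. Qed.
Lemma tprodM a a' b b' :
  tprod a b ** tprod a' b' = tprod (a * a') (b * b').
Proof. by rewrite /tprod /gen -cls_mul; apply/cls_rel/tensor_mul. Qed.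

Lemma tprod1P : nu_identity (tprod 1 1).
Proof.
apply: presented_identity => -[a b]; rewrite -/(tprod a b).
by rewrite !tprodM !mul1r !mulr1.
Qed.

(* Expansion of a term as a list of symbols. *)
Fixpoint expand (t : term K (A * B)) : seq (A * B) :=
  match t with
  | TGen p => [:: p]
  | TZero => [::]
  | TAdd s t => expand s ++ expand t
  | TScale k s => [seq (k *: p.1, p.2) | p <- expand s]
  | TMul s t => [seq (p.1 * q.1, p.2 * q.2) | p <- expand s, q <- expand t]
  end.

Lemma tensor_expand t :
  cls tensor_rel t = \sum_(p <- expand t) tprod p.1 p.2.
Proof.
elim: t => [[a b]||s IHs t IHt|k s IHs|s IHs t IHt] /=.
- by rewrite big_seq1.
- by rewrite big_nil.
- by rewrite cls_add big_cat IHs IHt.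
- rewrite cls_scale IHs big_map scaler_sumr.
  by apply: eq_bigr => p _; rewrite tprodZl.
- rewrite cls_mul IHs IHt big_allpairs_dep.
  elim: (expand s) => [|p l IHl].
    by rewrite !big_nil nu0mul.
  rewrite !big_cons numulDl IHl; congr (_ + _).
  elim: (expand t) => [|q r IHr].
    by rewrite !big_nil numul0.
  by rewrite !big_cons numulDr IHr tprodM.
Qed.

Section Universal.
Variable V : lmodType K.

Record bilinear_map (phi : A -> B -> V) : Prop := BilinearMap {
  bilDl : forall a a' b, phi (a + a') b = phi a b + phi a' b;
  bilDr : forall a b b', phi a (b + b') = phi a b + phi a b';
  bilZl : forall k a b, phi (k *: a) b = k *: phi a b;
  bilZr : forall k a b, phi a (k *: b) = k *: phi a b }.

Definition bsum (phi : A -> B -> V) (t : term K (A * B)) : V :=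
  \sum_(p <- expand t) phi p.1 p.2.

Lemma bsum_add phi s t : bsum phi (TAdd s t) = bsum phi s + bsum phi t.
Proof. by rewrite /bsum big_cat. Qed.

Lemma bsum_scale phi k s : bilinear_map phi ->
  bsum phi (TScale k s) = k *: bsum phi s.
Proof.
move=> h; rewrite /bsum big_map scaler_sumr.
by apply: eq_bigr => p _; rewrite bilZl.
Qed.

Lemma bsum_mull phi s t : bsum phi (TMul s t) =
  bsum (fun a b => bsum (fun a' b' => phi (a * a') (b * b')) t) s.
Proof. by rewrite /bsum /= big_allpairs_dep. Qed.

Lemma bsum_mulr phi s t : bsum phi (TMul s t) =
  bsum (fun a' b' => bsum (fun a b => phi (a * a') (b * b')) s) t.
Proof. by rewrite bsum_mull /bsum exchange_big. Qed.

Lemma bil_mull phi t : bilinear_map phi ->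
  bilinear_map (fun a b => bsum (fun a' b' => phi (a * a') (b * b')) t).
Proof.
move=> h; split=> *; rewrite /bsum -?big_split ?scaler_sumr /=;
  apply: eq_bigr => p _.
- by rewrite mulrDl (bilDl h).
- by rewrite mulrDl (bilDr h).
- by rewrite -scalerAl (bilZl h).
- by rewrite -scalerAl (bilZr h).
Qed.

Lemma bil_mulr phi s : bilinear_map phi ->
  bilinear_map (fun a' b' => bsum (fun a b => phi (a * a') (b * b')) s).
Proof.
move=> h; split=> *; rewrite /bsum -?big_split ?scaler_sumr /=;
  apply: eq_bigr => p _.
- by rewrite mulrDr (bilDl h).
- by rewrite mulrDr (bilDr h).
- by rewrite -scalerAr (bilZl h).
- by rewrite -scalerAr (bilZr h).
Qed.

Lemma bsum_ext phi psi t : (forall a b, phi a b = psi a b) ->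
  bsum phi t = bsum psi t.
Proof. by move=> e; apply: eq_bigr => p _; apply: e. Qed.

Lemma bsum_cong phi s t : bilinear_map phi -> cong tensor_rel s t ->
  bsum phi s = bsum phi t.
Proof.
move=> h st; elim: st phi h => {s t}.
- move=> s t [a a' b|a b b'|k a b|k a b|a a' b b'] phi h.
  + by rewrite bsum_add /bsum !big_seq1 (bilDl h).
  + by rewrite bsum_add /bsum !big_seq1 (bilDr h).
  + by rewrite bsum_scale // /bsum !big_seq1 (bilZl h).
  + by rewrite bsum_scale // /bsum !big_seq1 (bilZr h).
  + by [].
- by [].
- by move=> s t _ IH phi h; rewrite IH.
- by move=> s t u _ IH1 _ IH2 phi h; rewrite IH1 // IH2.
- by move=> s s' t t' _ IH1 _ IH2 phi h; rewrite !bsum_add IH1 // IH2.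
- by move=> k s s' _ IH phi h; rewrite !bsum_scale // IH.
- move=> s s' t t' _ IH1 _ IH2 phi h.
  rewrite bsum_mull (IH1 _ (bil_mull t h)) -bsum_mull bsum_mulr.
  by rewrite (IH2 _ (bil_mulr s' h)) -bsum_mulr.
- by move=> s t u phi h; rewrite !bsum_add addrA.
- by move=> s t phi h; rewrite !bsum_add addrC.
- by move=> s phi h; rewrite bsum_add [bsum _ TZero]big_nil add0r.
- move=> s phi h; rewrite bsum_add bsum_scale // [RHS]big_nil.
  by rewrite scaleN1r addNr.
- by move=> a b s phi h; rewrite !bsum_scale // scalerA.
- by move=> s phi h; rewrite bsum_scale // scale1r.
- by move=> a s t phi h; rewrite bsum_add !bsum_scale // bsum_add scalerDr.
- by move=> a b s phi h; rewrite bsum_add !bsum_scale // scalerDl.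
- move=> s t u phi h; rewrite bsum_mull [RHS]bsum_mull [RHS]bsum_mull.
  apply: bsum_ext => a b; rewrite bsum_mull; apply: bsum_ext => a' b'.
  by apply: bsum_ext => a'' b''; rewrite !mulrA.
- by move=> s t u phi h; rewrite bsum_add !bsum_mull bsum_add.
- by move=> s t u phi h; rewrite bsum_add !bsum_mulr bsum_add.
- move=> k s t phi h; rewrite bsum_scale // !bsum_mull bsum_scale //.
  exact: bil_mull.
- move=> k s t phi h; rewrite bsum_scale // !bsum_mulr bsum_scale //.
  exact: bil_mulr.
Qed.

Lemma tensor_universal (phi : A -> B -> V) : bilinear_map phi ->
  exists2 h : {linear tensor -> V}, (forall a b, h (tprod a b) = phi a b) &
    forall g : {linear tensor -> V},
      (forall a b, g (tprod a b) = phi a b) -> g =1 h.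
Proof.
move=> hphi; pose h (x : tensor) : V := bsum phi (rep x).
have hcls t : h (cls tensor_rel t) = bsum phi t.
  by apply: bsum_cong => //; apply: cong_rep.
have hlin : linear h.
  move=> k; elim/presW=> s; elim/presW=> t.
  by rewrite -cls_scale -cls_add !hcls bsum_add bsum_scale.
pose hM := GRing.isLinear.Build K tensor V *:%R h hlin.
pose hL : {linear tensor -> V} := HB.pack h hM.
exists hL => [a b|g hg]; first by rewrite /= [LHS]hcls /bsum big_seq1.
elim/presW=> t; rewrite /= hcls tensor_expand linear_sum /=.
by apply: eq_bigr => p _; rewrite hg.
Qed.

End Universal.

End Tensor.

Definition tensorL2 (K : fieldType) (R : algType K) : Type := tensor R (L2 K).
HB.instance Definition _ K R := NuAlgebra.on (@tensorL2 K R).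

Section TensorL2Ring.
Variables (K : fieldType) (R : algType K).
Local Notation RL2 := (tensorL2 R).
Local Notation one := (tprod (1 : R) (1 : L2 K) : RL2).

Lemma tensorL2_mul1 : left_id one (@numul K RL2).
Proof. by move=> x; have [] := @tprod1P K R (L2 K) x. Qed.
Lemma tensorL2_mulr1 : right_id one (@numul K RL2).
Proof. by move=> x; have [] := @tprod1P K R (L2 K) x. Qed.
Lemma tensorL2_one_neq0 : one != 0.
Proof.
pose phi (a : R) (x : L2 K) : R := a * L2_act x (fun=> 1 : R) 0%N.
have bil : bilinear_map phi.
  split=> *; rewrite /phi.
  - by rewrite mulrDl.
  - by rewrite L2_actD mulrDr.
  - by rewrite scalerAl.
  - by rewrite L2_actZ scalerAr.
have [h hE _] := tensor_universal bil.
apply/eqP => e; have := hE 1 1.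
by rewrite e linear0 /phi mul1r L2_act1 => /esym/eqP; rewrite oner_eq0.
Qed.

HB.instance Definition _ := GRing.Zmodule_isNzRing.Build RL2
  (@numulA K RL2) tensorL2_mul1 tensorL2_mulr1
  (@numulDl K RL2) (@numulDr K RL2) tensorL2_one_neq0.
HB.instance Definition _ := GRing.Lmodule_isLalgebra.Build K RL2
  (@nuscaleAl K RL2).
HB.instance Definition _ := GRing.Lalgebra_isAlgebra.Build K RL2
  (@nuscaleAr K RL2).

End TensorL2Ring.

(* MathComp makes [{poly B}] and ['M[B]_2] modules over B.  The following
   copies carry the K-algebra structures inherited from the one of B. *)
Definition poly_alg (K : fieldType) (B : algType K) : Type := {poly B}.

Section PolyAlg.
Variables (K : fieldType) (B : algType K).

HB.instance Definition _ := GRing.NzRing.on (poly_alg B).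

Definition poly_alg_scale (k : K) (p : poly_alg B) : poly_alg B :=
  (k%:A : B) *: (p : {poly B}).

Lemma poly_alg_scaleE k (p : poly_alg B) i :
  (poly_alg_scale k p : {poly B})`_i = k *: (p : {poly B})`_i.
Proof. by rewrite coefZ mulr_algl. Qed.

Lemma poly_alg_scaleA a b p :
  poly_alg_scale a (poly_alg_scale b p) = poly_alg_scale (a * b) p.
Proof. by apply/polyP => i; rewrite !poly_alg_scaleE scalerA. Qed.
Lemma poly_alg_scale1 : left_id 1 poly_alg_scale.
Proof. by move=> p; apply/polyP => i; rewrite poly_alg_scaleE scale1r. Qed.
Lemma poly_alg_scaleDr : right_distributive poly_alg_scale +%R.
Proof. by move=> a p q; rewrite /poly_alg_scale [LHS]scalerDr. Qed.
Lemma poly_alg_scaleDl p : {morph poly_alg_scale^~ p : a b / a + b}.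
Proof. by move=> a b; rewrite /poly_alg_scale scalerDl [LHS]scalerDl. Qed.
HB.instance Definition _ := GRing.Zmodule_isLmodule.Build K (poly_alg B)
  poly_alg_scaleA poly_alg_scale1 poly_alg_scaleDr poly_alg_scaleDl.

Lemma poly_alg_scaleAl (k : K) (p q : poly_alg B) : k *: (p * q) = k *: p * q.
Proof.
apply/polyP => i.
rewrite [LHS]poly_alg_scaleE [X in _ *: X]coefM [RHS]coefM scaler_sumr.
by apply: eq_bigr => j _; rewrite scalerAl poly_alg_scaleE.
Qed.
Lemma poly_alg_scaleAr (k : K) (p q : poly_alg B) : k *: (p * q) = p * (k *: q).
Proof.
apply/polyP => i.
rewrite [LHS]poly_alg_scaleE [X in _ *: X]coefM [RHS]coefM scaler_sumr.
by apply: eq_bigr => j _; rewrite scalerAr poly_alg_scaleE.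
Qed.
HB.instance Definition _ := GRing.Lmodule_isLalgebra.Build K (poly_alg B)
  poly_alg_scaleAl.
HB.instance Definition _ := GRing.Lalgebra_isAlgebra.Build K (poly_alg B)
  poly_alg_scaleAr.

End PolyAlg.

Definition mx2_alg (K : fieldType) (B : algType K) : Type := 'M[B]_2.

Section Mx2Alg.
Variables (K : fieldType) (B : algType K).

HB.instance Definition _ := GRing.NzRing.on (mx2_alg B).

Definition mx2_alg_scale (k : K) (M : mx2_alg B) : mx2_alg B :=
  (k%:A : B) *: (M : 'M[B]_2).

Lemma mx2_alg_scaleE k (M : mx2_alg B) i j :
  (mx2_alg_scale k M : 'M[B]_2) i j = k *: (M : 'M[B]_2) i j.
Proof. by rewrite mxE mulr_algl. Qed.

Lemma mx2_alg_scaleA a b M :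
  mx2_alg_scale a (mx2_alg_scale b M) = mx2_alg_scale (a * b) M.
Proof. by apply/matrixP => i j; rewrite !mx2_alg_scaleE scalerA. Qed.
Lemma mx2_alg_scale1 : left_id 1 mx2_alg_scale.
Proof. by move=> M; apply/matrixP => i j; rewrite mx2_alg_scaleE scale1r. Qed.
Lemma mx2_alg_scaleDr : right_distributive mx2_alg_scale +%R.
Proof. by move=> a M N; rewrite /mx2_alg_scale [LHS]scalerDr. Qed.
Lemma mx2_alg_scaleDl M : {morph mx2_alg_scale^~ M : a b / a + b}.
Proof. by move=> a b; rewrite /mx2_alg_scale scalerDl [LHS]scalerDl. Qed.
HB.instance Definition _ := GRing.Zmodule_isLmodule.Build K (mx2_alg B)
  mx2_alg_scaleA mx2_alg_scale1 mx2_alg_scaleDr mx2_alg_scaleDl.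

Lemma mx2_alg_scaleAl (k : K) (M N : mx2_alg B) : k *: (M * N) = k *: M * N.
Proof.
apply/matrixP => i j.
rewrite [LHS]mx2_alg_scaleE [X in _ *: X]mxE [RHS]mxE scaler_sumr.
by apply: eq_bigr => l _; rewrite scalerAl mx2_alg_scaleE.
Qed.
Lemma mx2_alg_scaleAr (k : K) (M N : mx2_alg B) : k *: (M * N) = M * (k *: N).
Proof.
apply/matrixP => i j.
rewrite [LHS]mx2_alg_scaleE [X in _ *: X]mxE [RHS]mxE scaler_sumr.
by apply: eq_bigr => l _; rewrite scalerAr mx2_alg_scaleE.
Qed.
HB.instance Definition _ := GRing.Lmodule_isLalgebra.Build K (mx2_alg B)
  mx2_alg_scaleAl.
HB.instance Definition _ := GRing.Lalgebra_isAlgebra.Build K (mx2_alg B)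
  mx2_alg_scaleAr.

End Mx2Alg.

(* Not necessarily unital homomorphisms. *)
Record alg_hom (K : fieldType) (A : nuAlgType K) (B : algType K) := AlgHom {
  alg_hom_linear :> {linear A -> B};
  alg_homM : forall x y, alg_hom_linear (x ** y) =
                         alg_hom_linear x * alg_hom_linear y }.

Section Homotopy.
Variables (K : fieldType) (A : nuAlgType K).

(* [A] carries no distinguished unit, so f is unital when A has an identity
   element and f sends it to 1; for A = L(E) see [lpa_oneP]. *)
Definition unital_hom (B : algType K) (f : alg_hom A B) : Prop :=
  exists2 u : A, nu_identity u & f u = 1.

Definition elementarily_homotopic (B : algType K) (f g : alg_hom A B) : Prop :=
  exists H : alg_hom A (poly_alg B),
    forall x, (H x : {poly B}).[0] = f x /\ (H x : {poly B}).[1] = g x.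

Definition homotopic (B : algType K) : alg_hom A B -> alg_hom A B -> Prop :=
  clos_refl_sym_trans _ (@elementarily_homotopic B).

Section Target.
Variable B : algType K.

Lemma zero_homM (x y : A) : (\0 : A -> B) (x ** y) = \0 x * \0 y.
Proof. by rewrite /= mul0r. Qed.
Definition zero_hom : alg_hom A B := @AlgHom K A B \0 zero_homM.

(* The upper left corner inclusion iota_2 : B -> M_2 B. *)
Definition corner (b : B) : mx2_alg B :=
  \matrix_(i, j) (if (i == 0) && (j == 0) then b else 0).

Lemma corner_linear : linear corner.
Proof.
move=> k b c; apply/matrixP => i j.
rewrite [RHS]mxE [X in _ = X + _]mx2_alg_scaleE !mxE.
by case: ifP; rewrite ?scaler0 ?addr0.
Qed.
HB.instance Definition _ := GRing.isLinear.Build K B (mx2_alg B) *:%R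
  corner corner_linear.

Lemma cornerM b c : corner (b * c) = corner b * corner c.
Proof.
apply/matrixP => i j; rewrite [RHS]mxE big_ord_recl big_ord1 !mxE /=.
by case: (i == 0); case: (j == 0); rewrite /= ?mul0r ?mulr0 ?addr0.
Qed.

Lemma corner_homM (f : alg_hom A B) x y :
  (corner \o f) (x ** y) = (corner \o f) x * (corner \o f) y.
Proof. by rewrite /= alg_homM cornerM. Qed.

Definition corner_hom (f : alg_hom A B) : alg_hom A (mx2_alg B) :=
  @AlgHom K A (mx2_alg B) (corner \o f) (corner_homM f).

Definition M2_homotopic (f g : alg_hom A B) : Prop :=
  homotopic (corner_hom f) (corner_hom g).

Lemma map_corner_linear :
  linear (map_poly corner : poly_alg B -> poly_alg (mx2_alg B)).
Proof.
move=> k p q; apply/polyP => i.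
rewrite [RHS]coefD [X in _ = X + _]poly_alg_scaleE !coef_map /= -linearP.
by congr corner; rewrite [LHS]coefD; congr (_ + _); apply: poly_alg_scaleE.
Qed.

Lemma map_cornerM (p q : {poly B}) :
  map_poly corner (p * q) = map_poly corner p * map_poly corner q.
Proof.
apply/polyP => i; rewrite coef_map !coefM /= raddf_sum.
by apply: eq_bigr => j _; rewrite !coef_map -cornerM.
Qed.

Lemma map_corner0 (p : {poly B}) : (map_poly corner p).[0] = corner p.[0].
Proof. by rewrite !horner_coef0 coef_map. Qed.

Lemma map_corner1 (p : {poly B}) : (map_poly corner p).[1] = corner p.[1].
Proof.
rewrite (horner_coef_wide 1 (size_poly _ _)) horner_coef /= raddf_sum.
by apply: eq_bigr => i _; rewrite !expr1n !mulr1 coef_map.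
Qed.

Lemma homotopic_M2 (f g : alg_hom A B) : homotopic f g -> M2_homotopic f g.
Proof.
elim=> {f g} [f g [H hH]|f|f g _|f h g _ fh _ hg].
- pose mp : poly_alg B -> poly_alg (mx2_alg B) := map_poly corner.
  have lin : linear (mp \o H).
    by move=> k x y; rewrite /= linearP; apply: map_corner_linear.
  pose hM := GRing.isLinear.Build K A (poly_alg (mx2_alg B)) *:%R (mp \o H) lin.
  pose L : {linear A -> poly_alg (mx2_alg B)} := HB.pack (mp \o H) hM.
  have LM x y : L (x ** y) = L x * L y.
    by rewrite /= alg_homM; apply: map_cornerM.
  apply: rst_step; exists (AlgHom LM) => x /=.
  by have [<- <-] := hH x; split; [apply: map_corner0 | apply: map_corner1].
- exact: rst_refl.
- exact: rst_sym.
- exact: rst_trans fh hg.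
Qed.

Definition hclass (f : alg_hom A B) : set (alg_hom A B) :=
  [set g | homotopic f g].
Definition M2class (f : alg_hom A B) : set (alg_hom A B) :=
  [set g | M2_homotopic f g].

(* [hset], [hset1] and [M2set] are the sets of classes [A, B], [A, B]_1 and
   [A, B]_{M_2}. *)
Definition hset : set (set (alg_hom A B)) := range hclass.
Definition hset1 : set (set (alg_hom A B)) :=
  hclass @` [set f | unital_hom f].
Definition M2set : set (set (alg_hom A B)) := range M2class.

(* The natural map [A, B] -> [A, B]_{M_2}: by [to_M2setE] below it sends the
   class of f to the class of f. *)
Definition to_M2set (C : set (alg_hom A B)) : set (alg_hom A B) :=
  [set g | exists2 f, C f & M2_homotopic f g].

Lemma to_M2setE (f : alg_hom A B) : to_M2set (hclass f) = M2class f.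
Proof.
apply/seteqP; split=> [g [f' ff' f'g]|g fg].
  exact: rst_trans (homotopic_M2 ff') f'g.
by exists f => //; apply: rst_refl.
Qed.

End Target.
End Homotopy.

Arguments hset {K} A B.
Arguments hset1 {K} A B.
Arguments M2set {K} A B.
Arguments zero_hom {K} A B.
Arguments to_M2set {K} A B.

(* [A, B]_{M_2} \ {0} *)
Definition M2set_nonzero (K : fieldType) (A : nuAlgType K) (B : algType K) :
  set (set (alg_hom A B)) := M2set A B `\ M2class (zero_hom A B).

Arguments M2set_nonzero {K} A B.

Definition division_ring (R : nzRingType) : Prop :=
  forall x : R, x <> 0 -> exists y, x * y = 1 /\ y * x = 1.

Definition purely_infinite_simple (R : nzRingType) : Prop :=
  ~ division_ring R /\
  (forall x : R, x <> 0 -> exists a b, a * x * b = 1).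

Section Modules.
Variable S : nzRingType.

Definition exact_at (L M N : lmodType S) (f : {linear L -> M})
    (g : {linear M -> N}) : Prop :=
  forall y, g y = 0 <-> exists x, f x = y.

Definition finitely_presented (M : lmodType S) : Prop :=
  exists (m n : nat) (f : {linear 'rV[S]_m -> 'rV[S]_n})
         (p : {linear 'rV[S]_n -> M}),
    exact_at f p /\ (forall y, exists x, p x = y).

Definition projective (P : lmodType S) : Prop :=
  forall (M N : lmodType S) (g : {linear M -> N}) (f : {linear P -> N}),
    (forall y, exists x, g x = y) ->
    exists h : {linear P -> M}, forall x, g (h x) = f x.

Definition finite_projective_dimension (M : lmodType S) : Prop :=
  exists (P : nat -> lmodType S) (d : forall i, {linear P i.+1 -> P i})
         (e : {linear P 0%N -> M}),
    (forall i, projective (P i)) /\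
    (forall y, exists x, e x = y) /\
    exact_at (d 0%N) e /\
    (forall i, exact_at (d i.+1) (d i)) /\
    (exists n, forall i, (n < i)%N -> forall x : P i, x = 0).

(* The full subcategory on the modules satisfying C is an abelian subcategory
   of the category of all modules: it is closed under the zero module, binary
   direct sums, and the kernels and cokernels taken in all modules. *)
Definition abelian_subcategory (C : lmodType S -> Prop) : Prop :=
  [/\ forall Z : lmodType S, (forall x : Z, x = 0) -> C Z,
      forall M N : lmodType S, C M -> C N -> C (M * N)%type,
      forall (M N : lmodType S) (f : {linear M -> N}), C M -> C N ->
        forall (L : lmodType S) (k : {linear L -> M}),
          injective k -> exact_at k f -> C L
    & forall (M N : lmodType S) (f : {linear M -> N}), C M -> C N ->
        forall (Q : lmodType S) (q : {linear N -> Q}),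
          (forall y, exists x, q x = y) -> exact_at f q -> C Q].

End Modules.

(* Right modules over S are left modules over the converse ring S^c. *)
Definition coherent (S : nzRingType) : Prop :=
  abelian_subcategory (@finitely_presented S^c).

Definition regular_coherent (S : nzRingType) : Prop :=
  coherent S /\
  (forall M : lmodType S^c,
     finitely_presented M -> finite_projective_dimension M).

Definition regular_supercoherent (R : nzRingType) : Prop :=
  forall n : nat, regular_coherent {mpoly R[n]}.

(* Main.v *)
From HB Require Import structures.
Require Import Defs.
From mathcomp Require Import all_boot all_algebra.
From mathcomp Require Import boolp classical_sets functions.
From Stdlib Require Import Relation_Operators.

Set Implicit Arguments.
Unset Strict Implicit.
Unset Printing Implicit Defensive.
Local Open Scope classical_set_scope.

(* Let B be L_2 or R (x) L_2, with x1, x2, y1, y2 the generators of L_2.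

   Rotating through the flip of the words x1 x2 and x2 x1, a unit of L_2 joined
   to 1, makes the identity of B homotopic to b |-> x1 b y1 + x2 b y2.  So a
   unit u of B is joined to diag(u, u), and hence diag(u, 1) is joined to 1.
   Every nonzero element of B is invertible up to two-sided multiplication
   (Cuntz's argument), which lets one split an identity summand off any unit of
   any corner pBp; therefore the units of pBp are all joined to p.

   Consequently two homomorphisms L(E) -> B which are both unital or both not
   unital are homotopic as soon as their values at each vertex v are equivalent
   idempotents: they become equal at the vertices after conjugation by a unit,
   and then differ at the edges by units of the corners.  Nonzero idempotents
   satisfy p ~ p + 1 (direct sum) and can be cancelled, so for a nonzero f there
   is h with f(v) + h(v) ~ 1 for all v.  If g is a homomorphism with g(v) ~ 1
   for all v, then f(v) ~ f(v) + 1 ~ f(v) + f(v) + h(v), hence f is homotopic to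
   (f + f) + h, therefore to f + h by the homotopy above, and so to g.  For
   M_2-homotopy the same applies to x1 f y1, the corner inclusion under the
   isomorphism M_2(B) = B. *)

(** * Homomorphisms and polynomial homotopies *)

Section Homs.
Import GRing.Theory.
Local Open Scope ring_scope.
Variable K : fieldType.

Lemma mk_hom (A : nuAlgType K) (C : algType K) (F : A -> C) :
  linear F -> (forall x y, F (x ** y) = F x * F y) ->
  exists h : alg_hom A C, forall x, h x = F x.
Proof.
move=> lin FM; pose L0 := GRing.isLinear.Build K A C *:%R F lin.
pose L : {linear A -> C} := HB.pack F L0.
by exists (@AlgHom K A C L FM).
Qed.

(** The cross terms vanish because [y1 x2 = y2 x1 = 0]. This is the direct sum of [f] and [g],
    carried from 2 by 2 matrices over [C] into [C] itself. *)
Lemma orthogonal_sum_hom (A : nuAlgType K) (C : algType K) (x1 x2 y1 y2 : C)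
    (f g : alg_hom A C) :
  y1 * x1 = 1 -> y1 * x2 = 0 -> y2 * x1 = 0 -> y2 * x2 = 1 ->
  exists h : alg_hom A C, forall z, h z = x1 * f z * y1 + x2 * g z * y2.
Proof.
move=> y1x1 y1x2 y2x1 y2x2; apply: mk_hom => [k a b|a b].
  rewrite !linearP !mulrDr !mulrDl -!scalerAr -!scalerAl scalerDr.
  exact: addrACA.
rewrite mulrDl !mulrDr !alg_homM !mulrA -!(mulrA _ y1) -!(mulrA _ y2).
by rewrite y1x1 y1x2 y2x1 y2x2 !mulr1 !mulr0 !mul0r addr0 add0r.
Qed.

Section Lift.
Variables (X : Type) (rel : term K X -> term K X -> Prop) (C : algType K).
Variable phi : X -> C.

Fixpoint term_eval (t : term K X) : C :=
  match t with
  | TGen x => phi x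
  | TZero => 0
  | TAdd s t => term_eval s + term_eval t
  | TScale k s => k *: term_eval s
  | TMul s t => term_eval s * term_eval t
  end.

(** Universal property of a presentation: [C] satisfies every axiom generating [cong], so evaluation
    is constant on congruence classes and can be computed on representatives. *)
Lemma presented_lift : (forall s t, rel s t -> term_eval s = term_eval t) ->
  exists h : alg_hom (presented rel) C, forall x, h (gen rel x) = phi x.
Proof.
move=> relE.
have congE s t : cong rel s t -> term_eval s = term_eval t.
  elim=> {s t} //=; first [by move=> *; congruence | move=> *].
  - by rewrite addrA.
  - by rewrite addrC.
  - by rewrite add0r.
  - by rewrite scaleN1r addNr.
  - by rewrite scalerA.
  - by rewrite scale1r.
  - by rewrite scalerDr.
  - by rewrite scalerDl.
  - by rewrite mulrA.
  - by rewrite mulrDl.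
  - by rewrite mulrDr.
  - by rewrite scalerAl.
  - by rewrite scalerAr.
have evalE t : term_eval (rep (cls rel t)) = term_eval t.
  exact/congE/cong_rep.
have lin : linear (fun x : presented rel => term_eval (rep x)).
  move=> k; elim/presW=> s; elim/presW=> t.
  by rewrite -cls_scale -cls_add !evalE.
have [|h hE] := mk_hom lin.
  by elim/presW=> s; elim/presW=> t; rewrite -cls_mul !evalE.
by exists h => x; rewrite hE /gen evalE.
Qed.

Lemma presented_ext (f g : alg_hom (presented rel) C) :
  (forall x, f (gen rel x) = g (gen rel x)) -> f =1 g.
Proof.
move=> fg; elim/presW; elim=> [x||s IHs t IHt|k s IHs|s IHs t IHt].
- exact: fg.
- by rewrite cls_zero !linear0.
- by rewrite cls_add !linearD IHs IHt.
- by rewrite cls_scale !linearZ IHs.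
- by rewrite cls_mul !alg_homM IHs IHt.
Qed.

End Lift.

Section Evaluation.
Variable B : algType K.

(** Over a noncommutative ring evaluation need not be multiplicative; at 0 and 1 it is, these points
    being central. *)
Lemma horner1M (p q : {poly B}) : (p * q).[1] = p.[1] * q.[1].
Proof. by apply: hornerM_comm; rewrite /comm_poly mulr1 mul1r. Qed.
Lemma horner0M (p q : {poly B}) : (p * q).[0] = p.[0] * q.[0].
Proof. by apply: hornerM_comm; rewrite /comm_poly mulr0 mul0r. Qed.

Lemma horner_one (c : B) : (1 : {poly B}).[c] = 1.
Proof. by rewrite -polyC1 hornerC. Qed.

Definition hornerP :=
  (horner_one, horner0M, horner1M, hornerD, hornerN, hornerC, hornerX).

Lemma poly_algZ_horner (k : K) (p : poly_alg B) c :
  (k *: p : {poly B}).[c] = k *: (p : {poly B}).[c].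
Proof. by rewrite [LHS]hornerZ mulr_algl. Qed.

Lemma polyC_linear : linear (polyC : B -> poly_alg B).
Proof.
move=> k a b; apply/polyP => i.
rewrite [RHS]coefD [X in _ = X + _]poly_alg_scaleE !coefC.
by case: eqP => _ //; rewrite scaler0 addr0.
Qed.

Lemma polyC_scale (k : K) (a : B) : (k *: a)%:P = k *: (a%:P : poly_alg B).
Proof. by have := polyC_linear k a 0; rewrite !polyC0 !addr0. Qed.

(** The Boolean selects the endpoint of the homotopy. *)
Lemma eval_hom (A : nuAlgType K) (H : alg_hom A (poly_alg B)) (c : bool) :
  exists h : alg_hom A B, forall x, h x = (H x : {poly B}).[c%:R].
Proof.
apply: mk_hom => [k x y|x y].
  by rewrite linearD linearZ hornerD poly_algZ_horner.
by rewrite alg_homM; case: c; [apply: horner1M | apply: horner0M].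
Qed.

End Evaluation.

Section Homotopies.
Variable A : nuAlgType K.

(** The constant homotopy takes the place of an equality between the two records. *)
Lemma homotopic_ext (B : algType K) (f g : alg_hom A B) : f =1 g -> homotopic f g.
Proof.
move=> fg; have lin : linear (fun x => (f x)%:P : poly_alg B).
  by move=> k x y; rewrite linearP polyC_linear.
have [|H HE] := mk_hom lin; first by move=> x y; rewrite alg_homM polyCM.
by apply: rst_step; exists H => x; rewrite HE !hornerC fg.
Qed.

Lemma homotopic_sym (B : algType K) (f g : alg_hom A B) :
  homotopic f g -> homotopic g f.
Proof. exact: rst_sym. Qed.

Lemma homotopic_trans (B : algType K) (g f h : alg_hom A B) :
  homotopic f g -> homotopic g h -> homotopic f h.
Proof. exact: rst_trans. Qed.

(** [th] need not preserve 1, yet it commutes with both evaluations: they return the constant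
    coefficient and the sum of the coefficients. *)
Lemma map_poly_hom (B C : algType K) (th : {linear B -> C})
    (H : alg_hom A (poly_alg B)) :
  (forall x y, th (x * y) = th x * th y) ->
  exists H' : alg_hom A (poly_alg C),
    [/\ forall x, (H' x : {poly C}) = map_poly th (H x : {poly B}),
        forall x, (H' x : {poly C}).[0] = th (H x : {poly B}).[0] &
        forall x, (H' x : {poly C}).[1] = th (H x : {poly B}).[1]].
Proof.
move=> thM; have lin : linear (fun x => map_poly th (H x) : poly_alg C).
  move=> k x y; rewrite linearP; apply/polyP => i.
  rewrite [RHS]coefD [X in _ = X + _]poly_alg_scaleE !coef_map /=.
  rewrite -[RHS]linearP; congr (th _).
  by rewrite [LHS]coefD; congr (_ + _); apply: poly_alg_scaleE.
have [x y|H' H'E] := mk_hom lin.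
  rewrite alg_homM; apply/polyP => i; rewrite coef_map !coefM /= raddf_sum.
  by apply: eq_bigr => j _; rewrite !coef_map -thM.
exists H'; split=> x; rewrite H'E //; first by rewrite !horner_coef0 coef_map.
rewrite (horner_coef_wide 1 (size_poly _ _)) horner_coef /= raddf_sum.
by apply: eq_bigr => i _; rewrite !expr1n !mulr1 coef_map.
Qed.

Lemma homotopic_post (B C : algType K) (th : {linear B -> C})
    (f g : alg_hom A B) (f' g' : alg_hom A C) :
  (forall x y, th (x * y) = th x * th y) ->
  (forall x, f' x = th (f x)) -> (forall x, g' x = th (g x)) ->
  homotopic f g -> homotopic f' g'.
Proof.
move=> thM f'E g'E fg; elim: fg f' g' f'E g'E => {f g}
    [f g [H hH]|f|f g _ IH|f h g _ IHf _ IHg] f' g' f'E g'E.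
- have [H' [_ H'0 H'1]] := map_poly_hom H thM.
  apply: rst_step; exists H' => x; rewrite H'0 H'1 f'E g'E.
  by have [-> ->] := hH x.
- by apply: homotopic_ext => x; rewrite f'E g'E.
- exact/homotopic_sym/IH.
(* The composite of [th] with the middle term must be made a homomorphism before the two halves can
   be chained. *)
- have lin : linear (fun x => th (h x)) by move=> k x y; rewrite !linearP.
  have [x y|h' h'E] := mk_hom lin; first by rewrite alg_homM thM.
  by apply: (@homotopic_trans _ h'); [apply: IHf | apply: IHg].
Qed.

End Homotopies.
End Homs.

(** * Units of corners joined to the identity *)

Section CornerUnits.
Import GRing.Theory.
Local Open Scope ring_scope.

(* u is a unit of the corner ring pCp with inverse u'. *)
Definition corner_unit (C : nzRingType) (p u u' : C) : Prop :=
  [/\ u * u' = p, u' * u = p, p * u = u & p * u' = u'].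

Section Generic.
Variable C : nzRingType.
Implicit Types p u v c m n w e : C.

Lemma corner_unitS p u u' : corner_unit p u u' -> corner_unit p u' u.
Proof. by case. Qed.

Lemma corner_unit_r p u u' : corner_unit p u u' -> u * p = u.
Proof. by case=> uu' u'u pu _; rewrite -u'u mulrA uu'. Qed.

Lemma corner_unit_idem p u u' : corner_unit p u u' -> p * p = p.
Proof. by case=> uu' _ pu _; rewrite -{2}uu' mulrA pu. Qed.

Lemma corner_unitM p u u' v v' : corner_unit p u u' -> corner_unit p v v' ->
  corner_unit p (u * v) (v' * u').
Proof.
move=> uP vP; have [uu u'u pu pu'] := uP; have [vv v'v pv pv'] := vP.
split.
- by rewrite mulrA -(mulrA u) vv (corner_unit_r uP).
- by rewrite mulrA -(mulrA v') u'u (corner_unit_r (corner_unitS vP)).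
- by rewrite mulrA pu.
- by rewrite mulrA pv'.
Qed.

Lemma corner_unit_inv p u u' u'' :
  corner_unit p u u' -> corner_unit p u u'' -> u' = u''.
Proof.
move=> uP uP2; have [_ u'u _ _] := uP; have [uu'' _ _ pu''] := uP2.
by rewrite -pu'' -u'u -mulrA uu'' (corner_unit_r (corner_unitS uP)).
Qed.

Lemma corner_unit_unip p c : p * p = p -> p * c = c -> c * p = c ->
  c * c = 0 -> corner_unit p (p + c) (p - c).
Proof.
move=> pp pc cp cc; split.
- by rewrite mulrDl !mulrBr pp pc cp cc subr0 subrK.
- by rewrite mulrBl !mulrDr pp pc cp cc addr0 addrK.
- by rewrite mulrDr pp pc.
- by rewrite mulrBr pp pc.
Qed.

(* n m = 1 makes y |-> m y n an isomorphism onto the corner of the idempotent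
   m n <= p; a unit is extended by the identity of p - m n. *)
Lemma corner_unit_transport p m n w w' : p * p = p -> n * m = 1 ->
  p * m = m -> n * p = n -> w * w' = 1 -> w' * w = 1 ->
  corner_unit p (p + m * (w - 1) * n) (p + m * (w' - 1) * n).
Proof.
move=> pp nm pm np.
have half (v v' : C) : v * v' = 1 ->
    (p + m * (v - 1) * n) * (p + m * (v' - 1) * n) = p.
  rewrite -{1}[v](subrK 1) -{1}[v'](subrK 1).
  move: (v - 1) (v' - 1) => z z' vv.
  (* Expansion of [v v' = 1], where now [v = z + 1] and [v' = z' + 1]. *)
  have zz : z + z' + z * z' = 0.
    apply: (addIr 1); rewrite add0r -[RHS]vv.
    by rewrite mulrDl !mulrDr !mulr1 !mul1r (addrC (z + z')) !addrA.
  rewrite mulrDl !mulrDr pp !mulrA pm -(mulrA _ n p) np -(mulrA _ n m) nm mulr1.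
  rewrite -[RHS]addr0 -addrA; congr (_ + _).
  by rewrite addrA -(mulrA m z z') -!mulrDl -!mulrDr (addrC z') zz mulr0 mul0r.
by move=> ww w'w; split; rewrite ?half // mulrDr pp !mulrA pm.
Qed.

End Generic.

Variables (K : fieldType) (B : algType K).
Implicit Types p u v c m n w e : B.

(** A path of units in the corner of [B[t]] at [p]. The inverse path is part of the data, since a
    polynomial whose values at 0 and 1 are units need not be a unit. *)
Definition connected p u u' : Prop := exists W W' : {poly B},
  [/\ corner_unit p%:P W W', W.[0] = p, W.[1] = u & W'.[1] = u'].

Lemma connected_unit p u u' : connected p u u' -> corner_unit p u u'.
Proof.
move=> [W [W' [[WW WW' pW pW'] _ <- <-]]].
have ev (P Q : {poly B}) (PQ : P = Q) := congr1 (fun P => P.[1]) PQ.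
by split; [have := ev _ _ WW|have := ev _ _ WW'|have := ev _ _ pW|have := ev _ _ pW'];
  rewrite !hornerP.
Qed.

(** Paths are multiplied pointwise instead of being concatenated, so one polynomial always
    suffices. *)
Lemma connectedM p u u' v v' : connected p u u' -> connected p v v' ->
  connected p (u * v) (v' * u').
Proof.
move=> [W [W' [WP W0 <- <-]]] [V [V' [VP V0 <- <-]]].
exists (W * V), (V' * W'); rewrite !hornerP; split=> //.
  exact: corner_unitM.
rewrite W0 V0; apply: polyC_inj; rewrite polyCM; exact: corner_unit_idem WP.
Qed.

Lemma connectedV p u u' : connected p u u' -> connected p u' u.
Proof.
move=> [W [W' [WP W0 <- <-]]]; exists W', W; split=> //.
  exact: corner_unitS.
have [WW _ _ pW'] := WP.
have := congr1 (fun Q : {poly B} => Q.[0]) WW; rewrite !hornerP W0 => <-.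
by have := congr1 (fun Q : {poly B} => Q.[0]) pW'; rewrite !hornerP => ->.
Qed.

(** The segment [p + c t] consists of units because [c t] has square zero. *)
Lemma connected_unip p c : p * p = p -> p * c = c -> c * p = c ->
  c * c = 0 -> connected p (p + c) (p - c).
Proof.
move=> pp pc cp cc; exists (p%:P + c%:P * 'X), (p%:P - c%:P * 'X); split.
- apply: corner_unit_unip.
  + by rewrite -polyCM pp.
  + by rewrite mulrA -polyCM pc.
  + by rewrite -mulrA -commr_polyX mulrA -polyCM cp.
  + rewrite mulrA -(mulrA c%:P) -commr_polyX mulrA -polyCM cc.
    by rewrite polyC0 !mul0r.
- by rewrite !hornerP mulr0 addr0.
- by rewrite !hornerP mulr1.
- by rewrite !hornerP mulr1.
Qed.

Lemma connected_transport p m n w w' : p * p = p -> n * m = 1 ->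
  p * m = m -> n * p = n -> connected 1 w w' ->
  connected p (p + m * (w - 1) * n) (p + m * (w' - 1) * n).
Proof.
move=> pp nm pm np [W [W' [[WW W'W _ _] W0 <- <-]]].
exists (p%:P + m%:P * (W - 1) * n%:P), (p%:P + m%:P * (W' - 1) * n%:P).
rewrite !hornerP W0 subrr mulr0 mul0r addr0; split=> //.
by apply: corner_unit_transport; rewrite -?polyCM ?pp ?nm ?pm ?np.
Qed.

Definition in_component p u : Prop := exists u', connected p u u'.

Lemma in_componentM p u v :
  in_component p u -> in_component p v -> in_component p (u * v).
Proof. by move=> [u' uc] [v' vc]; exists (v' * u'); apply: connectedM. Qed.

(** Inverses in a corner are unique, so the inverse hidden in [in_component] is the given one. *)
Lemma component_connected p u u' : in_component p u -> corner_unit p u u' ->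
  connected p u u'.
Proof.
move=> [u'' uc] uP.
by rewrite (corner_unit_inv uP (connected_unit uc)).
Qed.

Lemma component_divr p u v : u * p = u ->
  in_component p (u * v) -> in_component p v -> in_component p u.
Proof.
move=> up uv [v' vc]; have [vv _ _ _] := connected_unit vc.
have -> : u = u * v * v' by rewrite -mulrA vv.
apply: in_componentM => //.
by exists v; apply: connectedV.
Qed.

Lemma component_divl p u v : p * v = v ->
  in_component p (u * v) -> in_component p u -> in_component p v.
Proof.
move=> pv uv [u' uc]; have [_ u'u _ _] := connected_unit uc.
have -> : v = u' * (u * v) by rewrite mulrA u'u.
apply: in_componentM => //.
by exists u; apply: connectedV.
Qed.

(** In the matrix units of [m] and [n], the rotation by a right angle is a product of three
    elementary matrices, each unipotent and hence joined to 1. *)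
Lemma rotation m m' n n' :
  m' * m = 1 -> n' * n = 1 -> m' * n = 0 -> n' * m = 0 ->
  exists R R', [/\ connected 1 R R', R * m = n, R * n = - m, m' * R' = n' &
    forall z, m' * z = 0 -> n' * z = 0 -> R * z = z].
Proof.
move=> mm nn mn nm.
have E : connected 1 (1 + n * m') (1 - n * m').
  apply: connected_unip; rewrite ?mulr1 ?mul1r // mulrA.
  by rewrite -(mulrA n) mn mulr0 mul0r.
have F : connected 1 (1 - m * n') (1 + m * n').
  have := @connected_unip 1 (- (m * n')).
  rewrite opprK; apply; rewrite ?mulr1 ?mul1r //.
  by rewrite mulrNN mulrA -(mulrA m) nm mulr0 mul0r.
have := connectedM E (connectedM F E).
set R := (X in connected _ X _); set R' := (X in connected _ _ X).
exists R, R'; split=> // [|||z mz nz]; rewrite /R /R' {R R' H E F}.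
- have -> : (1 + n * m') * ((1 - m * n') * (1 + n * m')) * m =
      (1 + n * m') * ((1 - m * n') * ((1 + n * m') * m)) by rewrite !mulrA.
  have -> : (1 + n * m') * m = m + n by rewrite mulrDl mul1r -mulrA mm mulr1.
  have -> : (1 - m * n') * (m + n) = n.
    rewrite mulrBl mul1r mulrDr -!mulrA nm nn mulr0 mulr1 add0r.
    by rewrite addrAC subrr add0r.
  by rewrite mulrDl mul1r -mulrA mn mulr0 addr0.
- have -> : (1 + n * m') * ((1 - m * n') * (1 + n * m')) * n =
      (1 + n * m') * ((1 - m * n') * ((1 + n * m') * n)) by rewrite !mulrA.
  have -> : (1 + n * m') * n = n by rewrite mulrDl mul1r -mulrA mn mulr0 addr0.
  have -> : (1 - m * n') * n = n - m by rewrite mulrBl mul1r -mulrA nn mulr1.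
  rewrite mulrDl mul1r -mulrA mulrBr mn mm sub0r mulrN mulr1.
  by rewrite addrAC subrr add0r.
- rewrite !mulrA.
  have -> : m' * (1 - n * m') = m' by rewrite mulrBr mulr1 mulrA mn mul0r subr0.
  have -> : m' * (1 + m * n') = m' + n' by rewrite mulrDr mulr1 mulrA mm mul1r.
  rewrite mulrBr mulr1 mulrA mulrDl mn nn add0r mul1r.
  by rewrite addrAC subrr add0r.
- have -> : (1 + n * m') * ((1 - m * n') * (1 + n * m')) * z =
      (1 + n * m') * ((1 - m * n') * ((1 + n * m') * z)) by rewrite !mulrA.
  have -> : (1 + n * m') * z = z by rewrite mulrDl mul1r -mulrA mz mulr0 addr0.
  rewrite mulrBl mul1r -mulrA nz mulr0 subr0.
  by rewrite mulrDl mul1r -mulrA mz mulr0 addr0.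
Qed.

End CornerUnits.

(** * Homomorphisms from a Leavitt path algebra *)

Section LeavittHoms.
Import GRing.Theory.
Local Open Scope ring_scope.
Variables (K : fieldType) (E : finite_graph).
Local Notation vx v := (gen (@lpa_rel K E) (Vtx v)).
Local Notation ed e := (gen (@lpa_rel K E) (Edg e)).
Local Notation gh e := (gen (@lpa_rel K E) (Gho e)).
Variable C : algType K.
Implicit Types f g : alg_hom (leavitt K E) C.

Lemma hom_vv f v w : f (vx v) * f (vx w) = if v == w then f (vx v) else 0.
Proof. by rewrite -alg_homM lpa_vvE; case: eqP => // _; rewrite linear0. Qed.

Lemma hom_vE f v : f (vx v) * f (vx v) = f (vx v).
Proof. by rewrite hom_vv eqxx. Qed.

Lemma hom_v_orth f v w : v != w -> f (vx v) * f (vx w) = 0.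
Proof. by rewrite hom_vv => /negbTE ->. Qed.

Lemma hom_se f e : f (vx (source e)) * f (ed e) = f (ed e).
Proof. by rewrite -alg_homM -cls_mul; congr (f _); apply/cls_rel/lpa_se. Qed.
Lemma hom_et f e : f (ed e) * f (vx (target e)) = f (ed e).
Proof. by rewrite -alg_homM -cls_mul; congr (f _); apply/cls_rel/lpa_er. Qed.
Lemma hom_tg f e : f (vx (target e)) * f (gh e) = f (gh e).
Proof. by rewrite -alg_homM -cls_mul; congr (f _); apply/cls_rel/lpa_rg. Qed.
Lemma hom_gs f e : f (gh e) * f (vx (source e)) = f (gh e).
Proof. by rewrite -alg_homM -cls_mul; congr (f _); apply/cls_rel/lpa_gs. Qed.

Lemma hom_ck1 f e e' :
  f (gh e) * f (ed e') = if e == e' then f (vx (target e)) else 0.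
Proof.
rewrite -alg_homM -cls_mul (cls_rel (@lpa_ck1 K E e e')).
by case: eqP => // _; rewrite cls_zero linear0.
Qed.

Lemma hom_ck2 f v : (exists e, source e = v) ->
  f (vx v) = \sum_(e | source e == v) f (ed e) * f (gh e).
Proof.
move=> vP; rewrite /gen (cls_rel (lpa_ck2 K vP)) cls_sum linear_sum.
by apply: eq_bigr => e _; rewrite cls_mul alg_homM.
Qed.

Lemma hom_one f : f (lpa_one K E) = \sum_v f (vx v).
Proof. by rewrite linear_sum. Qed.

Lemma hom_1l f x : f (lpa_one K E) * f x = f x.
Proof. by rewrite -alg_homM (lpa_oneP x).1. Qed.
Lemma hom_1r f x : f x * f (lpa_one K E) = f x.
Proof. by rewrite -alg_homM (lpa_oneP x).2. Qed.

Lemma leavitt_ext f g : (forall v, f (vx v) = g (vx v)) ->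
  (forall e, f (ed e) = g (ed e)) -> (forall e, f (gh e) = g (gh e)) -> f =1 g.
Proof. by move=> fgv fge fgg; apply: presented_ext => -[]. Qed.

(** Universal property of L(E): a Cuntz-Krieger family in [C] extends to a homomorphism. *)
Lemma leavitt_family (p : vertex E -> C) (x y : edge E -> C) :
  (forall v w, p v * p w = if v == w then p v else 0) ->
  (forall e, p (source e) * x e = x e) -> (forall e, x e * p (target e) = x e) ->
  (forall e, p (target e) * y e = y e) -> (forall e, y e * p (source e) = y e) ->
  (forall e e', y e * x e' = if e == e' then p (target e) else 0) ->
  (forall v, (exists e, source e = v) ->
     p v = \sum_(e | source e == v) x e * y e) ->
  exists h : alg_hom (leavitt K E) C,
    [/\ forall v, h (vx v) = p v, forall e, h (ed e) = x e
      & forall e, h (gh e) = y e].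
Proof.
move=> pp px xp py yp yx pE.
pose phi (z : lpa_gen E) : C :=
  match z with Vtx v => p v | Edg e => x e | Gho e => y e end.
have [s t [v w|e|e|e|e|e e'|v vP] /=|h hE] :=
  @presented_lift K (lpa_gen E) (@lpa_rel K E) C phi; last first.
- by exists h; split=> z; rewrite hE.
- rewrite (big_morph (term_eval phi) (id1 := 0) (op1 := +%R)) //.
  exact: pE.
- by rewrite yx; case: eqP.
- exact: yp.
- exact: py.
- exact: xp.
- exact: px.
- by rewrite pp; case: eqP.
Qed.

End LeavittHoms.

(** * The homotopy class of the zero homomorphism *)

Section ZeroClass.
Import GRing.Theory.
Local Open Scope ring_scope.
Variable K : fieldType.

(* P = P^n is divisible by ('X - c)^n for all n. *)
Lemma idempotent_poly_root (C : nzRingType) (P : {poly C}) (c : C) :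
  (forall a, c * a = a * c) -> P * P = P -> P.[c] = 0 -> P = 0.
Proof.
move=> cc PP /eqP/factor_theorem[Q PQ].
have QX : GRing.comm Q ('X - c%:P).
  rewrite /GRing.comm mulrBr mulrBl commr_polyX; congr (_ - _).
  by apply/polyP => i; rewrite coefCM coefMC cc.
have PX n : P ^+ n.+1 = P by elim: n => // n IH; rewrite exprS IH.
(* The exponent [N] exceeds the size of [P], while a nonzero multiple of [('X - c)^N] has size
   greater than [N]. *)
have := PX (size P); rewrite {1}PQ exprMn_comm //; set N := (size P).+1 => PE.
apply/eqP; apply: contraT => P0.
have QN0 : Q ^+ N != 0.
  by apply: contra_neq P0 => QN; rewrite -PE QN mul0r.
have := size_Mmonic QN0 (monic_exp N (monicXsubC c)).
rewrite PE size_exp_XsubC addnS /= => sP; have := leq_addl (size (Q ^+ N)) N.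
by rewrite -sP ltnn.
Qed.

(** For a homotopy [H], the value [H(1)] is an idempotent polynomial. If it vanishes at an endpoint
    it vanishes identically, and so does [H = H(1) H]. *)
Lemma homotopic_zero (C : algType K) (E : finite_graph) (f g : alg_hom (leavitt K E) C) :
  homotopic f g -> (forall x, f x = 0) <-> (forall x, g x = 0).
Proof.
elim=> {f g} [f g [H hH]|//|f g _ IH|f h g _ IHf _ IHg]; last 2 first.
- by split=> /IH.
- by split=> [/IHf/IHg|/IHg/IHf].
have PP : (H (lpa_one K E) : {poly C}) * H (lpa_one K E) = H (lpa_one K E).
  exact: (hom_1l H).
have Hz (c : C) : (forall a, c * a = a * c) ->
    (H (lpa_one K E) : {poly C}).[c] = 0 -> forall x, H x = 0.
  move=> cc /(idempotent_poly_root cc PP) P0 x.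
  by rewrite -[LHS](hom_1l H) P0 mul0r.
split=> f0 x; have [Hf Hg] := hH x; have [H1f H1g] := hH (lpa_one K E).
  by rewrite -Hg (Hz 0) ?horner0 // => [a|]; rewrite ?mul0r ?mulr0 // H1f.
by rewrite -Hf (Hz 1) ?horner0 // => [a|]; rewrite ?mul1r ?mulr1 // H1g.
Qed.

Lemma M2_homotopic_zero (C : algType K) (E : finite_graph) (f : alg_hom (leavitt K E) C) :
  M2_homotopic (zero_hom (leavitt K E) C) f -> forall x, f x = 0.
Proof.
move=> h0f x; have [h _] := homotopic_zero h0f.
have /h/(_ x) : forall x, corner_hom (zero_hom (leavitt K E) C) x = 0.
  by move=> z; rewrite /= linear0.
by move/(congr1 (fun M : 'M[C]_2 => M 0 0)); rewrite /= !mxE.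
Qed.

End ZeroClass.

(** * Algebras absorbing L_2 *)

(* All that the proof uses of L_2 and of R (x) L_2. *)
Record absorbs_L2 (K : fieldType) (B : algType K) (x1 x2 y1 y2 : B) : Prop :=
  AbsorbsL2 {
    y1x1 : (y1 * x1 = 1)%R;
    y1x2 : (y1 * x2 = 0)%R;
    y2x1 : (y2 * x1 = 0)%R;
    y2x2 : (y2 * x2 = 1)%R;
    x1y1x2y2 : (x1 * y1 + x2 * y2 = 1)%R;
    two_sided_inv : forall b : B, b <> 0%R -> exists a c, (a * b * c = 1)%R;
    doubling_homotopy : exists H : {linear B -> poly_alg B},
      [/\ forall a b, H (a * b)%R = (H a * H b)%R, H 1%R = 1%R,
          forall b, ((H b : {poly B}).[0] = b)%R &
          forall b, ((H b : {poly B}).[1] = x1 * b * y1 + x2 * b * y2)%R] }.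

Section Target.
Import GRing.Theory.
Local Open Scope ring_scope.
Variables (K : fieldType) (B : algType K) (x1 x2 y1 y2 : B).
Hypothesis BP : absorbs_L2 x1 x2 y1 y2.
Implicit Types a b c d e m n p q u v w : B.

Let right_cancel a b (ab : a * b = 1) c : c * a * b = c.
Proof. by rewrite -mulrA ab mulr1. Qed.
Let right_kill a b (ab : a * b = 0) c : c * a * b = 0.
Proof. by rewrite -mulrA ab mulr0. Qed.
(** Rewrite rules for words in the generators; the versions with a left factor [c] act inside
    products associated to the left. *)
Let LE := (y1x1 BP, y1x2 BP, y2x1 BP, y2x2 BP,
  right_cancel (y1x1 BP), right_cancel (y2x2 BP),
  right_kill (y1x2 BP), right_kill (y2x1 BP), mul0r, mulr0, mul1r, mulr1).

(** * Units of the corners of [B] *)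

Lemma connected_conj u u' d d' : connected 1 u u' -> corner_unit 1 d d' ->
  connected 1 (d * u * d') (d * u' * d').
Proof.
move=> [W [W' [[WW W'W _ _] W0 <- <-]]] [dd' d'd _ _].
exists (d%:P * W * d'%:P), (d%:P * W' * d'%:P).
rewrite !hornerP W0 mulr1 dd'; split=> //.
have half V V' : V * V' = 1 ->
    d%:P * V * d'%:P * (d%:P * V' * d'%:P) = 1.
  move=> VV; rewrite !mulrA -(mulrA _ d'%:P) -polyCM d'd mulr1.
  by rewrite -(mulrA _ V) VV mulr1 -polyCM dd'.
by split; rewrite ?half ?mul1r.
Qed.

Section Rotation.
Variables m m' n n' : B.
Hypotheses (mm : m' * m = 1) (nn : n' * n = 1).
Hypotheses (mn : m' * n = 0) (nm : n' * m = 0).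

(** Let [d] extend [u] along [m]. The rotation [R] carries [d] to the extension along [n], and
    [R d R' = R (d R' d') d], where [d R' d'] is joined to 1 as a conjugate of [R']. *)
Lemma extension_swap u u' : corner_unit 1 u u' ->
  exists2 k, in_component 1 k &
    1 + n * (u - 1) * n' = k * (1 + m * (u - 1) * m').
Proof.
move=> [uu u'u _ _]; have [R [R' [RR Rm _ mR _]]] := rotation mm nn mn nm.
have [RR' _ _ _] := connected_unit RR.
have [d' dP] : exists d', corner_unit 1 (1 + m * (u - 1) * m') d'.
  exists (1 + m * (u' - 1) * m').
  by apply: corner_unit_transport; rewrite ?mul1r ?mulr1.
have -> : 1 + n * (u - 1) * n' = R * (1 + m * (u - 1) * m') * R'.
  rewrite [in RHS]mulrDr [in RHS]mulrDl mulr1 RR'; congr (_ + _).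
  by rewrite !mulrA Rm -!mulrA mR.
move: (1 + _) dP => d dP; have [dd d'd _ _] := dP.
exists (R * (d * R' * d')).
  apply: in_componentM; first by exists R'.
  by exists (d * R * d'); apply: connected_conj (connectedV RR) dP.
by rewrite -!mulrA d'd mulr1.
Qed.

End Rotation.

(** Let [v] be the extension of [u]. The doubling homotopy joins [v] to diag(v, v), which is the
    product of the extensions of [v] along [x1] and [x2]. Each of these is [v] up to a factor joined
    to 1, so [v] agrees with its square up to such factors and is itself joined to 1. *)
Lemma component_extension u u' : corner_unit 1 u u' ->
  in_component 1 (1 + x1 * (u - 1) * y1).
Proof.
move=> uP; have [uu u'u _ _] := uP.
have sw m m' n n' mm nn mn nm := @extension_swap m m' n n' mm nn mn nm u u' uP.
have [v' vP] : exists v', corner_unit 1 (1 + x1 * (u - 1) * y1) v'.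
  exists (1 + x1 * (u' - 1) * y1).
  by apply: corner_unit_transport; rewrite ?LE.
move vE : (1 + _) vP => v vP.
have [k1 k1P e1] : exists2 k, in_component 1 k & 1 + x1 * (v - 1) * y1 = k * v.
  have -> : 1 + x1 * (v - 1) * y1 = 1 + (x1 * x1) * (u - 1) * (y1 * y1).
    by rewrite -vE addrAC subrr add0r !mulrA.
  (* [x1] and [x1 x1] are not orthogonal, so the swap passes through [x2]. *)
  case: (sw x2 y2 (x1 * x1) (y1 * y1)) => [||||k kP ->]; rewrite ?mulrA ?LE //.
  case: (sw x1 y1 x2 y2) => [||||l lP ->]; rewrite ?LE //.
  by exists (k * l); [apply: in_componentM | rewrite mulrA vE].
have [k2 k2P e2] : exists2 k, in_component 1 k & 1 + x2 * (v - 1) * y2 = k * v.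
  have -> : 1 + x2 * (v - 1) * y2 = 1 + (x2 * x1) * (u - 1) * (y1 * y2).
    by rewrite -vE addrAC subrr add0r !mulrA.
  case: (sw x1 y1 (x2 * x1) (y1 * y2)) => [||||k kP ->]; rewrite ?mulrA ?LE //.
  by exists k; rewrite ?vE.
have e12 : x1 * v * y1 + x2 * v * y2 =
    (1 + x1 * (v - 1) * y1) * (1 + x2 * (v - 1) * y2).
  have mulr1D d e : d * e = 0 -> (1 + d) * (1 + e) = 1 + d + e.
    by move=> de; rewrite mulrDl mul1r mulrDr mulr1 de addr0 addrAC.
  rewrite mulr1D; last by rewrite !mulrA !LE.
  have subK2 c d a b : c + d + (a - c) + (b - d) = a + b.
    by rewrite -addrA addrACA (addrC c) (addrC d) !subrK.
  by rewrite !mulrBr !mulrBl !mulr1 -{1}(x1y1x2y2 BP) subK2.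
have [H [HM H1 H_0 H_1]] := doubling_homotopy BP.
have [vv v'v _ _] := vP.
(* The path is [H(v) v'], which starts at [v v' = 1]. *)
have k3P : in_component 1 ((x1 * v * y1 + x2 * v * y2) * v').
  exists (v * (x1 * v' * y1 + x2 * v' * y2)).
  exists ((H v : {poly B}) * v'%:P), (v%:P * (H v' : {poly B})).
  have Hvv : (H v : {poly B}) * H v' = 1 by rewrite -[LHS]HM vv.
  have Hv'v : (H v' : {poly B}) * H v = 1 by rewrite -[LHS]HM v'v.
  rewrite !hornerP H_0 !H_1 vv; split=> //; split; rewrite ?mul1r //.
    by rewrite mulrA -(mulrA _ v'%:P) -polyCM v'v mulr1.
  by rewrite mulrA -(mulrA _ (H v' : {poly B})) Hv'v mulr1 -polyCM vv.
have e3 : (x1 * v * y1 + x2 * v * y2) * v' = k1 * (v * k2).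
  by rewrite e12 e1 e2 !mulrA -(mulrA _ v v') vv mulr1.
rewrite e3 in k3P.
apply: component_divr k2P; first by rewrite mulr1.
by apply: component_divl k1P; rewrite ?mul1r.
Qed.

Lemma in_component_refl p : p * p = p -> in_component p p.
Proof.
move=> pp; have := @connected_unip _ _ p 0 pp.
by rewrite !mulr0 !mul0r addr0 => /(_ erefl erefl erefl); exists (p - 0).
Qed.

(* The path from 1 to 1 + x1 (v - e) y1 lives on x1 e B + r B = B with
   r = 1 - x1 e y1, and this module embeds into (e + e') B by e y1 + a r. *)
Lemma component_corner_sum e e' a b v v' : e * e = e -> e' * e' = e' ->
  e * e' = 0 -> e' * e = 0 -> b * a = 1 -> e' * a = a -> b * e' = b ->
  corner_unit e v v' -> in_component (e + e') (v + e').
Proof.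
move=> ee e'e' ee' e'e ba e'a be' vP; have [vv v'v ev ev'] := vP.
have ve := corner_unit_r vP; have v'e := corner_unit_r (corner_unitS vP).
have ea : e * a = 0 by rewrite -e'a mulrA ee' mul0r.
have be : b * e = 0 by rewrite -be' -mulrA e'e mulr0.
have half (z z' : B) : z * z' = e -> z * e = z -> e * z' = z' ->
    (1 + (z - e)) * (1 + (z' - e)) = 1.
  move=> zz ze ez'.
  have : (z - e) * (z' - e) = - (z - e) - (z' - e).
    by rewrite mulrBl !mulrBr zz ze ez' ee (opprB z).
  move: (z - e) (z' - e) => A A' AA.
  by rewrite mulrDl mul1r mulrDr mulr1 AA (addrA A) subrr sub0r addrK.
have uP : corner_unit 1 (1 + (v - e)) (1 + (v' - e)).
  by split; rewrite ?mul1r ?half.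
have [w' wc] := component_extension uP.
have : (1 - x1 * e * y1) * (1 - x1 * e * y1) = 1 - x1 * e * y1.
  have qq : x1 * e * y1 * (x1 * e * y1) = x1 * e * y1.
    by rewrite !mulrA !LE -(mulrA x1 e) ee.
  by rewrite mulrBl mul1r mulrBr mulr1 qq subrr subr0.
move rE : (1 - x1 * e * y1) => r rr.
pose m := e * y1 + a * r; pose n := x1 * e + r * b.
have pm : (e + e') * m = m.
  by rewrite /m mulrDl !mulrDr !mulrA ee ea e'e e'a !mul0r add0r addr0.
have np : n * (e + e') = n.
  rewrite /n mulrDl !mulrDr -!mulrA ee ee' be be' !mulr0.
  by rewrite add0r addr0.
have nm : n * m = 1.
  rewrite /n /m mulrDl !mulrDr !mulrA -(mulrA x1 e e) ee -(mulrA x1 e a) ea.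
  rewrite -(mulrA r b e) be -(mulrA r b a) ba !(mulr0, mul0r, mulr1) rr.
  by rewrite addr0 add0r -rE addrC subrK.
have pp : (e + e') * (e + e') = e + e'.
  by rewrite mulrDl !mulrDr ee ee' e'e e'e' addr0 add0r.
have := connected_transport pp nm pm np wc.
have -> : m * (1 + x1 * (1 + (v - e) - 1) * y1 - 1) * n = v - e.
  rewrite [1 + (x1 * _ * y1)]addrC addrK [1 + _]addrC addrK.
  have -> : m * (x1 * (v - e) * y1) = (v - e) * y1.
    have mx : m * x1 = e + a * x1 * (1 - e).
      have rx : r * x1 = x1 * (1 - e).
        by rewrite -rE mulrBl mul1r LE mulrBr mulr1.
      by rewrite mulrDl LE -!mulrA rx.
    have ez : e * (v - e) = v - e by rewrite mulrBr ev ee.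
    by rewrite !mulrA mx mulrDl -(mulrA (a * x1)) (mulrBl _ 1) mul1r ez subrr LE addr0.
  have yn : y1 * n = e + (1 - e) * y1 * b.
    have yr : y1 * r = (1 - e) * y1.
      by rewrite -rE mulrBr mulr1 !mulrA !LE mulrBl mul1r.
    by rewrite mulrDr !mulrA LE mul1r yr.
  have ze : (v - e) * e = v - e by rewrite mulrBl ve ee.
  rewrite -mulrA yn mulrDr !mulrA (mulrBr _ 1) mulr1 ze subrr.
  by rewrite !mul0r addr0.
have -> : e + e' + (v - e) = v + e' by rewrite addrC addrA subrK.
by move=> h;
exists (e + e' + m * (w' - 1) * n).
Qed.

(** The idempotent [f = s t] is equivalent to 1 and [w f = f], so [w] is block triangular for
    [p = e + f]. It splits into a unipotent and the diagonal unit [e w e + f]; the latter is joined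
    to [p] because [s] and [t] embed a copy of [B] in the corner at [f]. *)
Lemma component_fixing p w w' s t : corner_unit p w w' ->
  p * s = s -> t * p = t -> t * s = 1 -> w * s = s -> in_component p w.
Proof.
move=> wP ps tp ts ws; have [ww w'w pw pw'] := wP.
have wp := corner_unit_r wP; have w'p := corner_unit_r (corner_unitS wP).
have pp := corner_unit_idem wP.
have w's : w' * s = s by rewrite -{1}ws mulrA w'w ps.
pose f := s * t; pose e := p - f.
have ff : f * f = f by rewrite /f mulrA -(mulrA s) ts mulr1.
have pf : p * f = f by rewrite mulrA ps.
have fp : f * p = f by rewrite -mulrA tp.
have wf : w * f = f by rewrite mulrA ws.
have w'f : w' * f = f by rewrite mulrA w's.
have ef : e * f = 0 by rewrite mulrBl pf ff subrr.
have fe : f * e = 0 by rewrite mulrBr fp ff subrr.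
have pe : p * e = e by rewrite mulrBr pp pf.
have ep : e * p = e by rewrite mulrBl pp fp.
have ee : e * e = e by rewrite {1}/e mulrBl pe fe subr0.
have pE : p = e + f by rewrite subrK.
have fs : f * s = s by rewrite -mulrA ts mulr1.
have tf : t * f = t by rewrite mulrA ts mul1r.
clearbody e f.
have half (z z' : B) : z * z' = p -> z * f = f -> z * p = z ->
    e * z * e * (e * z' * e) = e.
  move=> zz zf zp.
  have ze : e * z = e * z * e.
    by rewrite -{1}zp {1}pE mulrDr zf mulrDr ef addr0 mulrA.
  by rewrite -ze !mulrA -ze -(mulrA e z) zz ep ee.
have vP : corner_unit e (e * w * e) (e * w' * e).
  by split; rewrite ?half // !mulrA ee.
have v'f : e * w' * e * f = 0 by rewrite -mulrA ef mulr0.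
have nP : in_component p (p + f * w * (e * w' * e)).
  exists (p - f * w * (e * w' * e)); apply: connected_unip => //.
  - by rewrite !mulrA pf.
  - by rewrite !mulrA -(mulrA _ e p) ep.
  - by rewrite !mulrA -(mulrA _ e f) ef mulr0 !mul0r.
have -> : w = (p + f * w * (e * w' * e)) * (e * w * e + f).
  rewrite mulrDl !mulrDr pf -(mulrA (f * w)) -(mulrA (f * w)) v'f mulr0 addr0.
  have -> : e * w' * e * (e * w * e) = e by apply: half.
  rewrite -(mulrA f) !mulrA pe -{1}pw -{1}wp pE mulrDl !mulrDr wf ef.
  by rewrite ff !mulrA addr0 -addrA [_ + f]addrC.
apply: in_componentM => //; rewrite {1}pE.
exact: (component_corner_sum (a := s) (b := t)) vP.
Qed.

(** The nonzero entry yields [s] and [l] with [l w s = 1] and [l s = 0]. Two unipotents then carry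
    [w s] back to [s], and the product of [w] with them fixes [s]. *)
Lemma component_offdiag p w w' f1 f2 : corner_unit p w w' ->
  f1 * p = f1 -> p * f2 = f2 -> f1 * f2 = 0 -> f1 * w * f2 <> 0 ->
  in_component p w.
Proof.
move=> wP f1p pf2 f12 /(two_sided_inv BP) [c [d cd]].
have [ww w'w pw pw'] := wP; have pp := corner_unit_idem wP.
pose s := f2 * d; pose l := c * f1.
have lws : l * w * s = 1 by rewrite /l /s !mulrA -cd !mulrA.
have ls : l * s = 0 by rewrite /l /s !mulrA -(mulrA c) f12 mulr0 mul0r.
have ps : p * s = s by rewrite mulrA pf2.
have lp : l * p = l by rewrite -mulrA f1p.
(* The correction by a multiple of [l] gives [k s = 1] and [k w s = 0]. *)
clearbody s l; pose k := l * w - l * w * w * s * l.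
have wp := corner_unit_r wP.
have ks : k * s = 1 by rewrite mulrBl lws -(mulrA _ l s) ls mulr0 subr0.
have kp : k * p = k by rewrite {1}/k mulrBl -(mulrA _ w p) wp -(mulrA _ l p) lp.
have kws : k * w * s = 0.
  by rewrite !mulrBl -(mulrA _ l w) -(mulrA _ (l * w)) lws mulr1 subrr.
clearbody k.
(* First [p + s l] sends [w s] to [w s + s]; then [p - w s k] removes [w s], leaving [s]. *)
have zP : in_component p ((p - w * s * k) * (p + s * l)).
  apply: in_componentM.
    exists (p - - (w * s * k)); apply: connected_unip => //.
    - by rewrite mulrN !mulrA pw.
    - by rewrite mulNr -!mulrA kp.
    - by rewrite mulrNN !mulrA -(mulrA _ k w) -(mulrA _ (k * w)) kws mulr0 mul0r.
  exists (p - s * l); apply: connected_unip => //.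
  - by rewrite !mulrA ps.
  - by rewrite -!mulrA lp.
  - by rewrite !mulrA -(mulrA s) ls mulr0 mul0r.
have [z' zc] := zP; have zwP := corner_unitM (connected_unit zc) wP.
apply: component_divl zP => //.
apply: (component_fixing zwP ps kp ks).
have -> : (p - w * s * k) * (p + s * l) * w * s = (p - w * s * k) * (w * s + s).
  by rewrite -!mulrA; congr (_ * _); rewrite mulrDl !mulrA pw -!mulrA (mulrA l) lws mulr1.
rewrite mulrDr !mulrBl !mulrA pw ps -!mulrA (mulrA k) kws ks !mulr0 mulr1 subr0.
by rewrite addrCA subrr addr0.
Qed.

(** Since [p] is nonzero, its corner contains a copy of [B], hence a splitting [p = f1 + f2] with
    both parts nonzero. If the entry [f1 w f2] vanishes, a unipotent factor makes it nonzero, and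
    the off-diagonal case applies. *)
Lemma corner_unit_component p w w' : corner_unit p w w' -> in_component p w.
Proof.
move=> wP; have [ww w'w pw pw'] := wP; have pp := corner_unit_idem wP.
have wp := corner_unit_r wP.
have [p0|/eqP p0] := eqVneq p 0.
  have -> : w = p by rewrite -pw p0 mul0r.
  exact: in_component_refl.
have [a0 [c0 ac]] := two_sided_inv BP p0.
pose a := p * c0; pose b := a0 * p.
have ba : b * a = 1 by rewrite /a /b mulrA -(mulrA a0) pp.
have pa : p * a = a by rewrite mulrA pp.
have bp : b * p = b by rewrite -mulrA pp.
clearbody a b; pose f2 := a * x2 * y2 * b; pose f1 := p - f2.
have f2f2 : f2 * f2 = f2.
  by rewrite /f2 !mulrA -(mulrA _ b a) ba !LE.
have pf2 : p * f2 = f2 by rewrite /f2 !mulrA pa.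
have f2p : f2 * p = f2 by rewrite /f2 -!mulrA bp.
have f1p : f1 * p = f1 by rewrite mulrBl pp f2p.
have pf1 : p * f1 = f1 by rewrite mulrBr pp pf2.
have f12 : f1 * f2 = 0 by rewrite mulrBl pf2 f2f2 subrr.
have f21 : f2 * f1 = 0 by rewrite mulrBr f2p f2f2 subrr.
have f11 : f1 * f1 = f1 by rewrite {1}/f1 mulrBl pf1 f21 subr0.
have [w12|/eqP] := eqVneq (f1 * w * f2) 0; last first.
  exact: component_offdiag wP f1p pf2 f12.
(* Chosen in [f1 B f2] with [n a x2 = f1]: if [f1 w n] vanished, so would [f1 w f1]. *)
pose n := f1 * y2 * b.
have nf2 : n * f2 = n.
  by rewrite /n /f2 !mulrA -(mulrA _ b a) ba mulr1 !LE.
have f1n : f1 * n = n by rewrite /n !mulrA f11.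
have nP : connected p (p + n) (p - n).
  apply: connected_unip => //.
  - by rewrite /n !mulrA pf1.
  - by rewrite -nf2 -mulrA f2p.
  - have -> : n * n = n * (f2 * f1) * n by rewrite mulrA nf2 -mulrA f1n.
    by rewrite f21 mulr0 mul0r.
apply: component_divr (ex_intro _ _ nP) => //.
apply: (component_offdiag (corner_unitM wP (connected_unit nP)) f1p pf2 f12).
rewrite mulrDr wp mulrDr mulrDl w12 add0r -2!mulrA nf2 => wn0.
have w11 : f1 * w * f1 = 0.
  have := congr1 (fun z => z * (a * x2)) wn0.
  by rewrite /n mul0r !mulrA -(mulrA _ b a) ba mulr1 !LE.
(* Both entries of [f1 w] vanish and [w] is a unit; but [f1 a x1 = a x1] has the left inverse
   [y1 b]. *)
have f10 : f1 = 0.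
  rewrite -f1p -ww mulrA -[w in f1 * w]wp -(subrK f2 p) -/f1 mulrA mulrDr.
  by rewrite w11 w12 addr0 mul0r.
have : f1 * a * x1 = 0 by rewrite f10 !mul0r.
rewrite /f1 /f2 mulrBl pa -!mulrA ba mulr1 mulrBl -!mulrA (y2x1 BP) !mulr0 subr0.
move=> ax; have := congr1 (fun z => y1 * b * z) ax.
rewrite mulr0 !mulrA -(mulrA y1) ba mulr1 (y1x1 BP) => /eqP.
by rewrite oner_eq0.
Qed.

(** * Equivalence of idempotents *)

(* Isomorphism of the projective modules pB and qB. *)
Definition equivalent p q : Prop :=
  exists a b, [/\ b * a = p, a * b = q, a * p = a & p * b = b].

Lemma equivalent_sym p q : equivalent p q -> equivalent q p.
Proof.
move=> [a [b [ba ab ap pb]]]; exists b, a; split=> //.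
  by rewrite -ab mulrA ba.
by rewrite -ab -mulrA ba.
Qed.

Lemma equivalent_idem p q : equivalent p q -> p * p = p.
Proof. by move=> [a [b [ba _ ap _]]]; rewrite -{1}ba -mulrA ap. Qed.

Lemma equivalent_refl p : p * p = p -> equivalent p p.
Proof. by exists p, p. Qed.

Lemma equivalent_trans q p r :
  equivalent p q -> equivalent q r -> equivalent p r.
Proof.
move=> [a [b [ba ab ap pb]]] [c [d [dc cd cq qd]]].
exists (c * a), (b * d); split.
- by rewrite mulrA -(mulrA b) dc -ab mulrA ba -mulrA ba -{2}ba mulrA pb.
- by rewrite mulrA -(mulrA c) ab cq.
- by rewrite -mulrA ap.
- by rewrite mulrA pb.
Qed.

Lemma equivalent_conj p m n : p * p = p -> n * m = 1 ->
  equivalent p (m * p * n).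
Proof.
move=> pp nm; exists (m * p), (p * n); split; rewrite ?mulrA.
- by rewrite -(mulrA p) nm mulr1.
- by rewrite -(mulrA m) pp.
- by rewrite -mulrA pp.
- by rewrite pp.
Qed.

Lemma equivalent_neq0 p q : equivalent p q -> p <> 0 -> q <> 0.
Proof.
by move=> [a [b [ba ab ap _]]] p0 q0; apply: p0; rewrite -ba -ap -ba !mulrA
  -(mulrA b a b) ab q0 mulr0 !mul0r.
Qed.

Lemma orthogonal_sumM (I : finType) (P : pred I) (F G : I -> B) :
  (forall i j, P i -> P j -> i != j -> F i * G j = 0) ->
  (\sum_(i | P i) F i) * (\sum_(j | P j) G j) = \sum_(i | P i) F i * G i.
Proof.
move=> FG; rewrite mulr_suml; apply: eq_bigr => i Pi.
rewrite mulr_sumr (bigD1 i) //= big1 ?addr0 // => j /andP[Pj ji].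
by apply: FG => //; rewrite eq_sym.
Qed.

Lemma equivalent_sum (I : finType) (P : pred I) (p q : I -> B) :
  (forall i, P i -> equivalent (p i) (q i)) ->
  (forall i j, P i -> P j -> i != j -> p i * p j = 0) ->
  (forall i j, P i -> P j -> i != j -> q i * q j = 0) ->
  equivalent (\sum_(i | P i) p i) (\sum_(i | P i) q i).
Proof.
move=> pq p_orth q_orth.
have /choice[ab abP] : forall i, exists ab : B * B, P i ->
    [/\ ab.2 * ab.1 = p i, ab.1 * ab.2 = q i, ab.1 * p i = ab.1,
        p i * ab.2 = ab.2 & ab.2 * q i = ab.2 /\ q i * ab.1 = ab.1].
  (* Outside [P] no equivalence is given, and [(0, 0)] is a filler. *)
  move=> i; case: (boolP (P i)) => [Pi|_]; last by exists (0, 0).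
  have [a [b [ba ab ap pb]]] := pq i Pi; exists (a, b) => _; split=> //=.
  by rewrite -ab mulrA ba -mulrA ba.
exists (\sum_(i | P i) (ab i).1), (\sum_(i | P i) (ab i).2); split.
- rewrite orthogonal_sumM => [|i j Pi Pj ij].
    by apply: eq_bigr => i /abP[].
  have [_ _ _ _ [<- _]] := abP i Pi; have [_ _ _ _ [_ <-]] := abP j Pj.
  by rewrite mulrA -(mulrA _ (q i)) q_orth // mulr0 mul0r.
- rewrite orthogonal_sumM => [|i j Pi Pj ij].
    by apply: eq_bigr => i /abP[].
  have [_ _ <- _ _] := abP i Pi; have [_ _ _ <- _] := abP j Pj.
  by rewrite mulrA -(mulrA _ (p i)) p_orth // mulr0 mul0r.
- rewrite orthogonal_sumM => [|i j Pi Pj ij].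
    by apply: eq_bigr => i /abP[].
  by have [_ _ <- _ _] := abP i Pi; rewrite -mulrA p_orth // mulr0.
- rewrite orthogonal_sumM => [|i j Pi Pj ij].
    by apply: eq_bigr => i /abP[].
  by have [_ _ _ <- _] := abP j Pj; rewrite mulrA p_orth // mul0r.
Qed.

Lemma equivalent_add p p' q q' : equivalent p p' -> equivalent q q' ->
  p * q = 0 -> q * p = 0 -> p' * q' = 0 -> q' * p' = 0 ->
  equivalent (p + q) (p' + q').
Proof.
move=> pp' qq' pq qp pq' qp'.
have := @equivalent_sum bool predT (fun i => if i then p else q)
  (fun i => if i then p' else q').
by rewrite !big_bool; apply=> [[]|[] []|[] []].
Qed.

(** The block sum diag(p, q), carried to [B] by the isomorphism of [M_2(B)] with [B]; it makes sense
    for idempotents that are not orthogonal. *)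
Definition dsum p q : B := x1 * p * y1 + x2 * q * y2.

Lemma dsum_conjl p : p * p = p -> equivalent p (x1 * p * y1).
Proof. by move=> pp; apply: equivalent_conj; rewrite ?LE. Qed.
Lemma dsum_conjr p : p * p = p -> equivalent p (x2 * p * y2).
Proof. by move=> pp; apply: equivalent_conj; rewrite ?LE. Qed.

Lemma dsum11 : dsum 1 1 = 1.
Proof. by rewrite /dsum !mulr1 (x1y1x2y2 BP). Qed.

Lemma equivalent_dsum p p' q q' : equivalent p p' -> equivalent q q' ->
  equivalent (dsum p q) (dsum p' q').
Proof.
move=> pp' qq'; have pp := equivalent_idem pp'.
have qq := equivalent_idem qq'.
have pp'' := equivalent_idem (equivalent_sym pp').
have qq'' := equivalent_idem (equivalent_sym qq').
apply: equivalent_add; rewrite ?mulrA ?LE //.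
- apply: equivalent_trans (equivalent_sym (dsum_conjl pp)) _.
  exact: equivalent_trans pp' (dsum_conjl pp'').
- apply: equivalent_trans (equivalent_sym (dsum_conjr qq)) _.
  exact: equivalent_trans qq' (dsum_conjr qq'').
Qed.

Lemma dsum_orthogonal p q : p * p = p -> q * q = q -> p * q = 0 -> q * p = 0 ->
  equivalent (dsum p q) (p + q).
Proof.
move=> pp qq pq qp; apply: equivalent_sym.
by apply: equivalent_add (dsum_conjl pp) (dsum_conjr qq) _ _ _ _;
  rewrite ?mulrA ?LE.
Qed.

Lemma dsum_idem p q : p * p = p -> q * q = q -> dsum p q * dsum p q = dsum p q.
Proof.
move=> pp qq; rewrite /dsum mulrDl !mulrDr !mulrA !LE add0r addr0.
by rewrite -(mulrA x1) pp -(mulrA x2) qq.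
Qed.

Lemma dsumC p q : p * p = p -> q * q = q -> equivalent (dsum p q) (dsum q p).
Proof.
move=> pp qq; rewrite /dsum [X in equivalent _ X]addrC.
apply: equivalent_add; rewrite ?mulrA ?LE //.
- exact: equivalent_trans (equivalent_sym (dsum_conjl pp)) (dsum_conjr pp).
- exact: equivalent_trans (equivalent_sym (dsum_conjr qq)) (dsum_conjl qq).
Qed.

(** Both sides are sums of three orthogonal copies, placed at [x1, x2 x1, x2 x2] and at
    [x1 x1, x1 x2, x2]; the copies are matched one by one. *)
Lemma dsumA p q r : p * p = p -> q * q = q -> r * r = r ->
  equivalent (dsum p (dsum q r)) (dsum (dsum p q) r).
Proof.
move=> pp qq rr.
have -> : dsum (dsum p q) r =
    x1 * (x1 * p * y1) * y1 + (x1 * (x2 * q * y2) * y1 + x2 * r * y2).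
  by rewrite {1}/dsum mulrDr mulrDl addrA.
have idemx1 z : z * z = z -> x1 * z * y1 * (x1 * z * y1) = x1 * z * y1.
  by move=> zz; rewrite !mulrA !LE -(mulrA x1 z) zz.
have idemx2 z : z * z = z -> x2 * z * y2 * (x2 * z * y2) = x2 * z * y2.
  by move=> zz; rewrite !mulrA !LE -(mulrA x2 z) zz.
have conj1 z : z * z = z -> equivalent (x1 * z * y1) (x1 * (x1 * z * y1) * y1).
  by move=> zz; apply: dsum_conjl; apply: idemx1.
have e1 : equivalent (x2 * q * y2) (x1 * (x2 * q * y2) * y1).
  exact/dsum_conjl/idemx2.
have e3 : equivalent (x1 * q * y1) (x1 * (x2 * q * y2) * y1).
  apply: equivalent_trans (equivalent_sym (dsum_conjl qq)) _.
  exact: equivalent_trans (dsum_conjr qq) e1.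
have e2 : equivalent (x2 * dsum q r * y2) (x1 * (x2 * q * y2) * y1 + x2 * r * y2).
  apply: equivalent_trans (equivalent_sym (dsum_conjr (dsum_idem qq rr))) _.
  by apply: (equivalent_add e3 (equivalent_refl (idemx2 _ rr)));
    rewrite ?mulrA ?LE.
apply: (equivalent_add (conj1 _ pp) e2).
- by rewrite !mulrA !LE.
- by rewrite !mulrA !LE.
- by rewrite mulrDr !mulrA !LE addr0.
- by rewrite mulrDl !mulrA !LE addr0.
Qed.

(** From [a p c = 1] comes a subidempotent [q] of [p] equivalent to 1, so [p] is equivalent to
    [dsum 1 (p - q)]. A further 1 is absorbed because [dsum 1 1 = 1]. *)
Lemma dsum_absorb1 p : p * p = p -> p <> 0 -> equivalent p (dsum p 1).
Proof.
move=> pp /(two_sided_inv BP) [a [c apc]].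
pose q := p * c * a * p.
have qq : q * q = q.
  rewrite /q !mulrA -(mulrA (p * c * a)) pp -(mulrA (p * c)) -(mulrA (p * c)).
  by rewrite apc mulr1 !mulrA.
have pq : p * q = q by rewrite /q !mulrA pp.
have qp : q * p = q by rewrite /q -!mulrA pp.
have q1 : equivalent q 1.
  exists (a * p), (p * c); split; rewrite /q ?mulrA //.
  - by rewrite -(mulrA a p p) pp.
  - by rewrite -(mulrA a p p) pp apc mul1r.
  - by rewrite -!mulrA (mulrA p p) pp (mulrA a) apc mulr1.
clearbody q; have [idem11 idempq] : (1 : B) * 1 = 1 /\ (p - q) * (p - q) = p - q.
  by rewrite mulr1 mulrBl !mulrBr pp pq qp qq subrr subr0.
have p1 : equivalent p (dsum 1 (p - q)).
  apply: equivalent_trans (equivalent_dsum q1 (equivalent_refl idempq)).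
  apply: equivalent_sym; rewrite -{2}(subrK q p) [_ + q]addrC.
  by apply: dsum_orthogonal; rewrite // ?mulrBl ?mulrBr ?pq ?qp ?qq subrr.
apply: (equivalent_trans p1); apply: equivalent_sym.
apply: equivalent_trans (dsumC pp idem11) _.
apply: equivalent_trans (equivalent_dsum (equivalent_refl idem11) p1) _.
by have := dsumA idem11 idem11 idempq; rewrite dsum11.
Qed.

Lemma dsum_complement p : p * p = p -> equivalent (dsum p (1 - p)) 1.
Proof.
move=> pp; have pq : p * (1 - p) = 0 by rewrite mulrBr mulr1 pp subrr.
have qp : (1 - p) * p = 0 by rewrite mulrBl mul1r pp subrr.
rewrite -[X in equivalent _ X](subrK p 1) [_ + p]addrC.
by apply: dsum_orthogonal; rewrite // mulrBl mul1r pq subr0.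
Qed.

(** Adding [1 - r] turns the summand [r] into 1, which the nonzero idempotents [p] and [q]
    absorb. *)
Lemma dsum_cancel p q r : p * p = p -> q * q = q -> r * r = r ->
  p <> 0 -> q <> 0 -> equivalent (dsum p r) (dsum q r) -> equivalent p q.
Proof.
move=> pp qq rr p0 q0 pr.
have r'r' : (1 - r) * (1 - r) = 1 - r.
  by rewrite mulrBl mul1r mulrBr mulr1 rr subrr subr0.
have absorb z : z * z = z -> z <> 0 ->
    equivalent z (dsum (dsum z r) (1 - r)).
  move=> zz z0; apply: equivalent_trans (dsum_absorb1 zz z0) _.
  apply: equivalent_trans (dsumA zz rr r'r').
  apply: equivalent_dsum (equivalent_refl zz) _.
  exact/equivalent_sym/dsum_complement.
apply: equivalent_trans (absorb _ pp p0) _.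
apply: equivalent_trans (equivalent_sym (absorb _ qq q0)).
exact: equivalent_dsum pr (equivalent_refl r'r').
Qed.

(** * Homotopy of homomorphisms from a Leavitt path algebra *)

(** Every unit of [B] is joined to 1, and conjugation by the path is the homotopy. *)
Lemma conj_homotopic (A : nuAlgType K) (f g : alg_hom A B) a a' :
  corner_unit 1 a a' -> (forall x, g x = a * f x * a') -> homotopic f g.
Proof.
move=> aP gE; have ac := component_connected (corner_unit_component aP) aP.
have [W [W' [[WW W'W _ _] W0 W1 W'1]]] := ac.
have W'0 : W'.[0] = 1.
  have := congr1 (fun P : {poly B} => P.[0]) WW.
  by rewrite !hornerP W0 mul1r.
have lin : linear (fun x => W * (f x)%:P * W' : poly_alg B).
  move=> k x y; rewrite linearP /= polyC_linear.
  by rewrite -[W * _]/((W : poly_alg B) * _) mulrDr mulrDl -scalerAr -scalerAl.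
have [x y|H HE] := mk_hom lin.
  rewrite alg_homM polyCM -[RHS]/(W * (f x)%:P * W' * (W * (f y)%:P * W')).
  by rewrite !mulrA -(mulrA _ W') W'W mulr1.
apply: rst_step; exists H => x; rewrite HE !hornerP W0 W'0 W1 W'1 gE.
by rewrite mul1r mulr1.
Qed.

Section Graph.
Variable E : finite_graph.
Local Notation vx v := (gen (@lpa_rel K E) (Vtx v)).
Local Notation ed e := (gen (@lpa_rel K E) (Edg e)).
Local Notation gh e := (gen (@lpa_rel K E) (Gho e)).
Implicit Types f g h : alg_hom (leavitt K E) B.

(* g(e) = w_(s(e)) f(e) where w_v is a unit of the corner at v. *)
Lemma same_vertices_homotopic f g :
  (forall v : vertex E, f (vx v) = g (vx v)) -> homotopic f g.
Proof.
move=> fg.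
have half (f' g' : alg_hom (leavitt K E) B) (v : vertex E) :
    (forall v : vertex E, f' (vx v) = g' (vx v)) ->
    (exists e : edge E, source e = v) ->
    (\sum_(e : edge E | source e == v) g' (ed e) * f' (gh e)) *
    (\sum_(e : edge E | source e == v) f' (ed e) * g' (gh e)) = f' (vx v).
  move=> fg' vP; rewrite orthogonal_sumM => [|e e' _ _ ee'].
    rewrite fg' (hom_ck2 _ vP); apply: eq_bigr => e _.
    by rewrite mulrA -(mulrA _ (f' (gh e))) hom_ck1 eqxx fg' hom_et.
  by rewrite mulrA -(mulrA _ (f' (gh e))) hom_ck1 (negbTE ee') mulr0 mul0r.
pose w (v : vertex E) := \sum_(e : edge E | source e == v) g (ed e) * f (gh e).
pose w' (v : vertex E) := \sum_(e : edge E | source e == v) f (ed e) * g (gh e).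
have wP (v : vertex E) : (exists e : edge E, source e = v) -> corner_unit (f (vx v)) (w v) (w' v).
  move=> vP; split; first exact: half.
  - by rewrite fg; apply: half => // u; rewrite fg.
  - rewrite mulr_sumr; apply: eq_bigr => e /eqP <-.
    by rewrite mulrA fg hom_se.
  - rewrite mulr_sumr; apply: eq_bigr => e /eqP <-.
    by rewrite mulrA hom_se.
have /choice[W WP] : forall v : vertex E, exists W : {poly B} * {poly B},
    (exists e : edge E, source e = v) ->
    [/\ corner_unit (f (vx v))%:P W.1 W.2, W.1.[0] = f (vx v),
        W.1.[1] = w v & W.2.[1] = w' v].
  (* At a sink no edge has to be moved, and the pair [(0, 0)] is a filler. *)
  move=> v; case: (pselect (exists e : edge E, source e = v)) => [vP|nvP]; last first.
    by exists (0, 0) => /nvP.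
  have [W [W' WW']] :=
    component_connected (corner_unit_component (wP v vP)) (wP v vP).
  by exists (W, W').
have We (e : edge E) : [/\ corner_unit (f (vx (source e)))%:P (W (source e)).1 (W (source e)).2,
    (W (source e)).1.[0] = f (vx (source e)),
    (W (source e)).1.[1] = w (source e) & (W (source e)).2.[1] = w' (source e)].
  by apply: WP; exists e.
(* The homotopy is constant at the vertices, multiplies each edge on the left by the path at its
   source, and each ghost edge on the right by the inverse path. *)
pose p (v : vertex E) : {poly B} := (f (vx v))%:P.
pose x (e : edge E) : {poly B} := (W (source e)).1 * (f (ed e))%:P.
pose y (e : edge E) : {poly B} := (f (gh e))%:P * (W (source e)).2.
have W'p (e : edge E) : (W (source e)).2 * (f (vx (source e)))%:P = (W (source e)).2.
  by have [Wc _ _ _] := We e; apply: corner_unit_r (corner_unitS Wc).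
have W'0 (e : edge E) : (W (source e)).2.[0] = f (vx (source e)).
  have [[WW _ _ pW'] W0 _ _] := We e.
  have := congr1 (fun P : {poly B} => P.[0]) pW'; rewrite !hornerP => <-.
  by have := congr1 (fun P : {poly B} => P.[0]) WW; rewrite !hornerP W0.
have [|e|e|e|e|e e'|v [e0 <-]|H [Hv He Hg]] :=
    @leavitt_family K E (poly_alg B) p x y.
- move=> v u; rewrite -[LHS]polyCM hom_vv; case: eqP => // _.
- have [[_ _ pW _] _ _ _] := We e.
  by rewrite -[LHS]/(p _ * x e) mulrA pW.
- by rewrite -[LHS]/(x e * p _) -mulrA -polyCM hom_et.
- by rewrite -[LHS]/(p _ * y e) mulrA -polyCM hom_tg.
- by rewrite -[LHS]/(y e * p _) -mulrA W'p.
- rewrite -[LHS]/(y e * x e') mulrA -(mulrA _ (W (source e)).2).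
  have [see'|see'] := eqVneq (source e) (source e').
    have [[_ W'W _ _] _ _ _] := We e'.
    rewrite see' W'W -polyCM -see' hom_gs -polyCM hom_ck1.
    by case: eqP.
  have [[_ _ pW _] _ _ _] := We e'.
  have -> : (W (source e)).2 * (W (source e')).1 = 0.
    rewrite -pW -(W'p e) -mulrA (mulrA (f (vx (source e)))%:P) -polyCM.
    by rewrite hom_v_orth // polyC0 mul0r mulr0.
  rewrite mulr0 mul0r.
  by case: eqP => // ee'; rewrite ee' eqxx in see'.
- have [Wc _ _ _] := We e0; have [WW' _ _ _] := Wc.
  transitivity ((W (source e0)).1 * p (source e0) * (W (source e0)).2).
    by rewrite (corner_unit_r Wc) WW'.
  rewrite {1}/p hom_ck2; last by exists e0.
  rewrite -[polyC]/(polyC : B -> {poly B}) raddf_sum /= mulr_sumr mulr_suml.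
  apply: eq_bigr => e /eqP se; rewrite polyCM /x /y se.
  by rewrite -[RHS]/(_ * _ * (_ * _)) !mulrA.
apply: rst_step; exists H => z.
have [h0 h0E] := eval_hom H false; have [h1 h1E] := eval_hom H true.
rewrite -(h0E z) -(h1E z); split.
  apply: leavitt_ext => [v|e|e]; rewrite h0E ?Hv ?He ?Hg !hornerP //.
    by have [_ -> _ _] := We e; rewrite hom_se.
  by rewrite W'0 hom_gs.
apply: leavitt_ext => [v|e|e]; rewrite h1E ?Hv ?He ?Hg !hornerP //.
  have [_ _ -> _] := We e; rewrite /w mulr_suml (bigD1 e) //= big1.
    by rewrite addr0 -mulrA hom_ck1 eqxx fg hom_et.
  by move=> e' /andP[_ ee']; rewrite -mulrA hom_ck1 (negbTE ee') mulr0.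
have [_ _ _ ->] := We e; rewrite /w' mulr_sumr (bigD1 e) //= big1.
  by rewrite addr0 mulrA hom_ck1 eqxx fg hom_tg.
by move=> e' /andP[_ ee']; rewrite mulrA hom_ck1 eq_sym (negbTE ee') mul0r.
Qed.

(** The equivalences at the vertices add up to one between [p = f(1)] and [q = g(1)]. Together with
    an equivalence of [1 - p] and [1 - q] they form a unit [a0] conjugating [f] to a homomorphism
    that equals [g] at the vertices. *)
Lemma equivalent_vertices_homotopic f g :
  (forall v : vertex E, equivalent (f (vx v)) (g (vx v))) ->
  (f (lpa_one K E) = 1 <-> g (lpa_one K E) = 1) -> homotopic f g.
Proof.
move=> fg fg1; set p := f _ in fg1; set q := g _ in fg1.
have pp : p * p = p := hom_1l f _; have qq : q * q = q := hom_1l g _.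
have idemC (z : B) : z * z = z -> (1 - z) * (1 - z) = 1 - z.
  by move=> zz; rewrite mulrBl mul1r mulrBr mulr1 zz subrr subr0.
have pq : equivalent p q.
  rewrite /p /q !hom_one; apply: equivalent_sum => //; by move=> *; apply: hom_v_orth.
(* Cancellation requires nonzero idempotents; the condition on units makes both complements vanish
   or neither. *)
have [c [d [dc cd cp pd]]] : equivalent (1 - p) (1 - q).
  case: (pselect (p = 1)) => [p1|p1].
    have q1 := fg1.1 p1; rewrite p1 q1 subrr.
    by apply: equivalent_refl; rewrite mulr0.
  have neq0 (z : B) : z <> 1 -> 1 - z <> 0.
    by move=> z1 /eqP; rewrite subr_eq0 => /eqP /esym.
  apply: (dsum_cancel (idemC _ pp) (idemC _ qq) pp (neq0 _ p1)).
    by apply: neq0 => /fg1.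
  apply: (equivalent_trans (dsumC (idemC _ pp) pp)).
  apply: (equivalent_trans (dsum_complement pp)).
  apply: (equivalent_trans (equivalent_sym (dsum_complement qq))).
  apply: (equivalent_trans (dsumC qq (idemC _ qq))).
  exact: (equivalent_dsum (equivalent_refl (idemC _ qq)) (equivalent_sym pq)).
have /choice[ab abP] : forall v : vertex E, exists ab : B * B,
    [/\ ab.2 * ab.1 = f (vx v), ab.1 * ab.2 = g (vx v), ab.1 * f (vx v) = ab.1,
        f (vx v) * ab.2 = ab.2 & ab.2 * g (vx v) = ab.2 /\
        g (vx v) * ab.1 = ab.1].
  move=> v; have [a [b [ba ab ap pb]]] := fg v; exists (a, b); split=> //=.
  by rewrite -ab mulrA ba -mulrA ba.
pose a (v : vertex E) := (ab v).1; pose b (v : vertex E) := (ab v).2.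
have aP (v : vertex E) : a v * f (vx v) = a v by have [] := abP v.
have bP (v : vertex E) : f (vx v) * b v = b v by have [] := abP v.
have ba (v : vertex E) : b v * a v = f (vx v) by have [] := abP v.
have abE (v : vertex E) : a v * b v = g (vx v) by have [] := abP v.
have aq (v : vertex E) : g (vx v) * a v = a v by have [_ _ _ _ []] := abP v.
have bq (v : vertex E) : b v * g (vx v) = b v by have [_ _ _ _ []] := abP v.
have dq : d * (1 - q) = d by rewrite -cd mulrA dc pd.
have qc : (1 - q) * c = c by rewrite -cd -mulrA dc cp.
have pf (v : vertex E) : p * f (vx v) = f (vx v) by apply: hom_1l.
have fp (v : vertex E) : f (vx v) * p = f (vx v) by apply: hom_1r.
have qg (v : vertex E) : q * g (vx v) = g (vx v) by apply: hom_1l.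
have gq (v : vertex E) : g (vx v) * q = g (vx v) by apply: hom_1r.
have cf (v : vertex E) : c * f (vx v) = 0.
  by rewrite -cp -mulrA mulrBl mul1r pf subrr mulr0.
have fd (v : vertex E) : f (vx v) * d = 0.
  by rewrite -pd mulrA mulrBr mulr1 fp subrr mul0r.
have dg (v : vertex E) : d * g (vx v) = 0.
  by rewrite -dq -mulrA mulrBl mul1r qg subrr mulr0.
have gc (v : vertex E) : g (vx v) * c = 0.
  by rewrite -qc mulrA mulrBr mulr1 gq subrr mul0r.
pose a0 := (\sum_v a v) + c; pose b0 := (\sum_v b v) + d.
have a0f (v : vertex E) : a0 * f (vx v) = a v.
  rewrite /a0 mulrDl cf addr0 mulr_suml (bigD1 v) //= big1 ?addr0 // => u uv.
  by rewrite -aP -mulrA hom_v_orth // mulr0.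
have fb0 (v : vertex E) : f (vx v) * b0 = b v.
  rewrite /b0 mulrDr fd addr0 mulr_sumr (bigD1 v) //= big1 ?addr0 // => u uv.
  by rewrite -bP mulrA hom_v_orth ?mul0r // eq_sym.
have b0g (v : vertex E) : b0 * g (vx v) = b v.
  rewrite /b0 mulrDl dg addr0 mulr_suml (bigD1 v) //= big1 ?addr0 // => u uv.
  by rewrite -bq -mulrA hom_v_orth // mulr0.
have ba0 : b0 * a0 = 1.
  have -> : b0 * a0 = \sum_v b0 * a v + b0 * c by rewrite -mulr_sumr -mulrDr.
  have -> : b0 * c = 1 - p.
    rewrite /b0 mulrDl mulr_suml big1 ?add0r // => v _.
    by rewrite -bq -mulrA gc mulr0.
  rewrite (eq_bigr (fun v : vertex E => f (vx v))) => [|v _].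
    by rewrite -hom_one addrC subrK.
  by rewrite -aq mulrA b0g ba.
have ab0 : a0 * b0 = 1.
  have -> : a0 * b0 = \sum_v a0 * b v + a0 * d by rewrite -mulr_sumr -mulrDr.
  have -> : a0 * d = 1 - q.
    rewrite /a0 mulrDl mulr_suml big1 ?add0r // => v _.
    by rewrite -aP -mulrA fd mulr0.
  rewrite (eq_bigr (fun v : vertex E => g (vx v))) => [|v _].
    by rewrite -hom_one addrC subrK.
  by rewrite -bP mulrA a0f abE.
clearbody a0 b0; have lin : linear (fun x => a0 * f x * b0).
  by move=> k x y; rewrite linearP mulrDr mulrDl -scalerAr -scalerAl.
have [x y|f' f'E] := mk_hom lin.
  by rewrite alg_homM !mulrA -(mulrA _ b0) ba0 mulr1.
apply: (@homotopic_trans _ _ _ f').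
  by apply: (conj_homotopic (a := a0) (a' := b0)) f'E; split; rewrite ?mul1r.
apply: (same_vertices_homotopic) => v.
by rewrite f'E -hom_vE mulrA a0f -mulrA fb0 abE.
Qed.

(** * Homomorphisms with prescribed idempotents at the vertices *)

(** The Leavitt relations identifying [B] with matrices over [B] indexed by [P]. *)
Definition isometries (I : finType) (P : pred I) (S T : I -> B) : Prop :=
  (forall i j, P i -> P j -> T i * S j = (i == j)%:R) /\
  \sum_(i | P i) S i * T i = 1.

(** The words [x1, x2 x1, x2 x2 x1, ...], ending with [x2^k]. The bound [k] counts [k + 1] elements,
    as an empty family cannot sum to 1. *)
Lemma isometries_ord (k : nat) : exists S T : nat -> B,
  (forall i j, (i <= k)%N -> (j <= k)%N -> T i * S j = (i == j)%:R) /\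
  \sum_(i < k.+1) S i * T i = 1.
Proof.
elim: k => [|k [S [T [TS ST]]]].
  exists (fun=> 1), (fun=> 1); rewrite big_ord1 mulr1; split=> // i j.
  by rewrite !leqn0 => /eqP -> /eqP ->; rewrite /= ?mulr1.
exists (fun i => if i is i'.+1 then x2 * S i' else x1),
  (fun i => if i is i'.+1 then T i' * y2 else y1); split.
  by move=> [|i] [|j] //= ik jk; rewrite ?mulrA ?LE // eqSS TS.
rewrite big_ord_recl /= -[RHS](x1y1x2y2 BP); congr (_ + _).
rewrite -[x2 in RHS]mulr1 -ST mulr_sumr mulr_suml.
by apply: eq_bigr => i _; rewrite /= /bump /= !mulrA.
Qed.

Lemma isometries_exist (I : finType) (P : pred I) (i0 : I) : P i0 ->
  exists S T, isometries P S T.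
Proof.
move=> Pi0; have /card_gt0P : exists i, i \in P by exists i0.
have [S [T [TS ST]]] := isometries_ord #|P|.-1.
move=> P0; rewrite prednK // in ST.
have PE i : P i -> (enum_rank_in Pi0 i <= #|P|.-1)%N.
  by move=> _; rewrite -ltnS prednK.
exists (fun i => S (enum_rank_in Pi0 i)), (fun i => T (enum_rank_in Pi0 i)).
split=> [i j Pi Pj|].
  rewrite TS ?PE //; congr (_%:R); congr nat_of_bool.
  apply/eqP/eqP => [/ord_inj ij|-> //].
  exact: (enum_rank_in_inj Pi Pj ij).
rewrite -[LHS]/(\sum_(i in P) _) big_enum_val -ST; apply: eq_bigr => i _.
by rewrite enum_valK_in.
Qed.

Section Conjugates.
Variables (I : finType) (P : pred I) (S T : I -> B).
Hypothesis STP : isometries P S T.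
Variable z : I -> B.
Hypothesis zz : forall i, P i -> z i * z i = z i.

Lemma isometries_conjM i j (a b : B) : P i -> P j ->
  (S i * a * T i) * (S j * b * T j) = if i == j then S i * (a * b) * T i else 0.
Proof.
move=> Pi Pj; rewrite !mulrA -(mulrA _ (T i)) STP.1 //.
by case: eqP => [->|_]; rewrite ?mulr1 // mulr0 !mul0r.
Qed.

Lemma isometries_conj_orth i j (a b : B) : P i -> P j -> i != j ->
  (S i * a * T i) * (S j * b * T j) = 0.
Proof. by move=> Pi Pj ij; rewrite isometries_conjM // (negbTE ij). Qed.

Lemma isometries_conj i : P i -> equivalent (z i) (S i * z i * T i).
Proof.
by move=> Pi; apply: equivalent_conj (zz Pi) _; rewrite STP.1 // eqxx.
Qed.

Lemma isometries_comp i : P i ->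
  T i * (\sum_(j | P j) S j * z j * T j) * S i = z i.
Proof.
move=> Pi; rewrite mulr_sumr mulr_suml (bigD1 i) //= big1 => [|j /andP[Pj ji]].
  by rewrite !mulrA STP.1 // -mulrA STP.1 // !eqxx mulr1 mul1r addr0.
by rewrite !mulrA STP.1 // eq_sym (negbTE ji) !mul0r.
Qed.

Lemma isometries_sum_idem :
  (\sum_(j | P j) S j * z j * T j) * (\sum_(j | P j) S j * z j * T j) =
  \sum_(j | P j) S j * z j * T j.
Proof.
rewrite orthogonal_sumM => [|i j]; last exact: isometries_conj_orth.
by apply: eq_bigr => i Pi; rewrite isometries_conjM // eqxx zz.
Qed.

End Conjugates.

(** The hypothesis is the vertex relation of L(E) at the level of equivalence classes. The
    isometries [S], [T] make the idempotents of distinct vertices orthogonal, and an equivalence at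
    [v] provides the edges leaving [v]. *)
Lemma realize (v0 : vertex E) (z : vertex E -> B) :
  (forall v : vertex E, z v * z v = z v) ->
  (forall v : vertex E, (exists e : edge E, source e = v) ->
     forall S T : edge E -> B, isometries (fun e : edge E => source e == v) S T ->
     equivalent (z v) (\sum_(e : edge E | source e == v) S e * z (target e) * T e)) ->
  exists h (S T : vertex E -> B), isometries predT S T /\
    forall v : vertex E, h (vx v) = S v * z v * T v.
Proof.
move=> zz zE; have [S [T ST]] := @isometries_exist _ predT v0 isT.
have /choice[xy xyP] : forall v : vertex E,
    exists xy : (edge E -> B) * (edge E -> B), (exists e : edge E, source e = v) ->
    (forall e e' : edge E, source e = v -> source e' = v ->
       xy.2 e * xy.1 e' = if e == e' then z (target e) else 0) /\
    [/\ z v = \sum_(e : edge E | source e == v) xy.1 e * xy.2 e,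
      forall e : edge E, z v * xy.1 e = xy.1 e,
      forall e : edge E, xy.2 e * z v = xy.2 e,
      forall e : edge E, xy.1 e * z (target e) = xy.1 e
    & forall e : edge E, z (target e) * xy.2 e = xy.2 e].
  move=> v; case: (pselect (exists e : edge E, source e = v)) => [vP|nvP];
    last by exists (fun=> 0, fun=> 0) => /nvP.
  have [e0 /eqP se0] := vP.
  have [U [V UV]] := @isometries_exist _ (fun e : edge E => source e == v) e0 se0.
  have [a [b [ba ab az zb]]] := zE v vP U V UV.
  (* The equivalence [a], [b] identifies [z v] with the block sum over the edges; [U e] and [V e]
     select the block of [e]. *)
  exists (fun e : edge E => b * (U e * z (target e)),
    fun e : edge E => z (target e) * V e * a).
  move=> _ /=; split=> [e e' /eqP se /eqP se'|].
    have -> : z (target e) * V e * a * (b * (U e' * z (target e'))) =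
        z (target e) * (V e * (a * b) * U e') * z (target e') by rewrite !mulrA.
    have [<-|ee'] := eqVneq e e'.
      by rewrite ab isometries_comp // !zz.
    rewrite ab mulr_sumr mulr_suml big1 ?mulr0 ?mul0r // => i si.
    rewrite !mulrA; have [ei|ei] := eqVneq e i; last first.
      by rewrite UV.1 // (negbTE ei) !mul0r.
    by rewrite -ei -(mulrA _ (V e)) (UV.1 e e') // (negbTE ee') mulr0.
  split=> [|e|e|e|e].
  - rewrite -(zz v) -ba mulrA -(mulrA b) ab mulr_sumr mulr_suml.
    by apply: eq_bigr => e _; rewrite !mulrA -(mulrA _ (z _) (z _)) zz.
  - by rewrite mulrA zb.
  - by rewrite -mulrA az.
  - by rewrite -!mulrA zz.
  - by rewrite !mulrA zz.
have xyE (e : edge E) := xyP (source e) (ex_intro _ e erefl).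
pose x (e : edge E) := S (source e) * (xy (source e)).1 e * T (target e).
pose y (e : edge E) := S (target e) * (xy (source e)).2 e * T (source e).
have TS (u v : vertex E) : T u * S v = (u == v)%:R by rewrite ST.1.
have sand (u v w : vertex E) (a b : B) : (S u * a * T v) * (S v * b * T w) =
    S u * (a * b) * T w.
  by rewrite !mulrA -(mulrA _ (T v)) TS eqxx mulr1.
have [v w|e|e|e|e|e e'|v vP|h [hv _ _]] :=
    @leavitt_family K E B (fun v : vertex E => S v * z v * T v) x y.
- by rewrite (isometries_conjM ST) //; case: eqP => // <-; rewrite zz.
- by rewrite sand; have [_ [_ -> _ _ _]] := xyE e.
- by rewrite sand; have [_ [_ _ _ -> _]] := xyE e.
- by rewrite sand; have [_ [_ _ _ _ ->]] := xyE e.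
- by rewrite sand; have [_ [_ _ -> _ _]] := xyE e.
- have [see'|see'] := eqVneq (source e) (source e').
    rewrite /x /y see' sand; have [-> //] := xyE e'.
    by case: eqP => [->//|_]; rewrite mulr0 mul0r.
  rewrite /x /y !mulrA -(mulrA _ (T (source e))) TS (negbTE see').
  rewrite mulr0 !mul0r; case: eqP => // ee'.
  by rewrite ee' eqxx in see'.
- have [_ [-> _ _ _ _]] := xyP v vP; rewrite mulr_sumr mulr_suml.
  by apply: eq_bigr => e /eqP <-; rewrite sand.
by exists h, S, T.
Qed.

Lemma dsum_eq1 p q : dsum p q = 1 <-> p = 1 /\ q = 1.
Proof.
split=> [pq|[-> ->]]; last exact: dsum11.
have := congr1 (fun z => y1 * z * x1) pq; have := congr1 (fun z => y2 * z * x2) pq.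
rewrite /= /dsum !mulrDr !mulrDl !mulrA !LE ?add0r ?addr0.
by move=> -> ->.
Qed.

Lemma one_neq0_prop : (1 : B) <> 0.
Proof. by move/eqP; rewrite oner_eq0. Qed.

Lemma x2_neq0 : x2 <> 0.
Proof. by move=> x20; apply: one_neq0_prop; rewrite -(y2x2 BP) x20 mulr0. Qed.

(** The left side kills [x2], and [x2] is nonzero. So corner copies of homomorphisms are never
    unital. *)
Lemma corner_neq1 a : x1 * a * y1 <> 1.
Proof.
move=> /(congr1 (fun z => z * x2)); rewrite /= -(mulrA _ y1) LE mulr0 mul1r.
by move/esym/x2_neq0.
Qed.

Lemma corner_copy f : exists h, forall x, h x = x1 * f x * y1.
Proof.
apply: mk_hom => [k x y|x y].
  by rewrite linearP mulrDr mulrDl -scalerAr -scalerAl.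
by rewrite alg_homM !mulrA LE.
Qed.

Lemma dsum_hom f g : exists h, forall x, h x = dsum (f x) (g x).
Proof. exact: (orthogonal_sum_hom _ _ (y1x1 BP) (y1x2 BP) (y2x1 BP) (y2x2 BP)). Qed.

(** The constant family 1 satisfies the vertex relations, since [S e * T e] sums to 1 over the edges
    leaving [v]. *)
Lemma standard_hom (v0 : vertex E) : exists g,
  (forall v : vertex E, equivalent (g (vx v)) 1) /\ g (lpa_one K E) = 1.
Proof.
have [v|v _ S T [_ ST]|g [S [T [ST gE]]]] := realize v0 (z := fun=> 1).
- exact: mulr1.
- rewrite (eq_bigr (fun e : edge E => S e * T e)) => [|e _]; last by rewrite mulr1.
  by rewrite ST; apply: equivalent_refl; rewrite mulr1.
exists g; split=> [v|].
  rewrite gE; apply: equivalent_sym.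
  by apply: (isometries_conj ST (z := fun=> 1)) => // i _; rewrite mulr1.
rewrite hom_one -ST.2; apply: eq_bigr => v _.
by rewrite gE mulr1.
Qed.

(** Replacing [f(v)] by the copy [q v] keeps the complement [z v] nonzero. The vertex relations for
    [z] follow from those for [f] by cancellation, so [realize] applies. *)
Lemma complement_hom (v0 : vertex E) f : exists h,
  (forall v : vertex E, equivalent (h (vx v)) (1 - x1 * f (vx v) * y1)) /\
  (f (lpa_one K E) = 1 -> h (lpa_one K E) = 1).
Proof.
pose q (v : vertex E) := x1 * f (vx v) * y1.
pose z (v : vertex E) : B := 1 - q v.
have qq (v : vertex E) : q v * q v = q v by rewrite /q !mulrA LE -(mulrA x1) hom_vE.
have zz (v : vertex E) : z v * z v = z v.
  by rewrite /z mulrBl mul1r mulrBr mulr1 qq subrr subr0.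
have zq (v : vertex E) : z v * q v = 0 by rewrite /z mulrBl mul1r qq subrr.
have qz (v : vertex E) : q v * z v = 0 by rewrite /z mulrBr mulr1 qq subrr.
have fq (v : vertex E) : equivalent (f (vx v)) (q v) by apply/dsum_conjl/hom_vE.
(* [z v] fixes [x2]. *)
have z_neq0 (v : vertex E) : z v <> 0.
  move=> /(congr1 (fun b => b * x2)); rewrite /= /z /q mulrBl mul1r.
  by rewrite !LE subr0 => /x2_neq0.
have zE (v : vertex E) : z v = 1 - x1 * f (vx v) * y1 by [].
clearbody q; have zDq (v : vertex E) : z v + q v = 1 by rewrite /z subrK.
clearbody z.
have zfE (v : vertex E) : equivalent (dsum (z v) (f (vx v))) 1.
  rewrite -(zDq v).
  apply: (equivalent_trans (equivalent_dsum (equivalent_refl (zz v)) (fq v))).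
  exact: dsum_orthogonal.
(* The complement of an isometric sum of the z's is the sum of the q's. *)
have sum_dsum (I : finType) (P : pred I) (t : I -> vertex E) (S T : I -> B) r :
    isometries P S T ->
    equivalent r (\sum_(i | P i) S i * q (t i) * T i) ->
    equivalent (dsum (\sum_(i | P i) S i * z (t i) * T i) r) 1.
  move=> ST rE; have zI := isometries_sum_idem ST (fun i _ => zz (t i)).
  have qI := isometries_sum_idem ST (fun i _ => qq (t i)).
  apply: (equivalent_trans (equivalent_dsum (equivalent_refl zI) rE)).
  have -> : 1 = \sum_(i | P i) S i * z (t i) * T i +
                \sum_(i | P i) S i * q (t i) * T i.
    rewrite -big_split -ST.2; apply: eq_bigr => i _ /=.
    by rewrite -mulrDl -mulrDr zDq mulr1.
  have orth (a b : vertex E -> B) : (forall v : vertex E, a v * b v = 0) ->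
      (\sum_(i | P i) S i * a (t i) * T i) *
      (\sum_(i | P i) S i * b (t i) * T i) = 0.
    move=> ab; rewrite orthogonal_sumM => [|i j]; last exact: (isometries_conj_orth ST).
    rewrite big1 // => i Pi.
    by rewrite (isometries_conjM ST) // eqxx ab mulr0 mul0r.
  by apply: dsum_orthogonal => //; apply: orth.
have sum_neq0 (I : finType) (P : pred I) (t : I -> vertex E) (S T : I -> B) i :
    isometries P S T -> P i -> \sum_(i | P i) S i * z (t i) * T i <> 0.
  move=> ST Pi /(congr1 (fun b => T i * b * S i)).
  rewrite /= (isometries_comp ST (fun i => z (t i))) // mulr0 mul0r.
  exact: z_neq0.
have [v|v [e0 /eqP se0] S T ST|h [S [T [ST hE]]]] := realize v0 (z := z).
- exact: zz.
(* Adding [f(v)] completes [z v] to 1. It also completes the sum over the edges to 1, because [f(v)]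
   is the sum of copies of [f] at their targets. *)
- apply: (dsum_cancel (zz v) _ (hom_vE f v) (z_neq0 v)).
  + exact: (isometries_sum_idem ST (fun (e : edge E) _ => zz (target e))).
  + exact: sum_neq0 ST se0.
  + apply: (equivalent_trans (zfE v)); apply: equivalent_sym.
    apply: sum_dsum => //; rewrite (hom_ck2 f); last by exists e0; apply/eqP.
    apply: equivalent_sum => [e se|e e' _ _ ee'|e e' se se' ee'].
    * apply: (equivalent_trans (q := q (target e))); last first.
        exact: (isometries_conj ST (fun (e : edge E) _ => qq (target e))).
      apply: equivalent_trans (fq (target e)).
      exists (f (gh e)), (f (ed e)); split.
      - by [].
      - by rewrite hom_ck1 eqxx.
      - by rewrite mulrA hom_ck1 eqxx hom_tg.
      - by rewrite -mulrA hom_ck1 eqxx hom_et.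
    * by rewrite !mulrA -(mulrA _ (f (gh e))) hom_ck1 (negbTE ee') mulr0 mul0r.
    * exact: (isometries_conj_orth ST).
have hz (v : vertex E) : equivalent (h (vx v)) (z v).
  rewrite hE; apply: equivalent_sym.
  exact: (isometries_conj ST (fun (v : vertex E) _ => zz v)).
have hz' (v : vertex E) : equivalent (h (vx v)) (1 - x1 * f (vx v) * y1).
  by rewrite -zE.
have h1E : h (lpa_one K E) = \sum_v S v * z v * T v.
  by rewrite hom_one; apply: eq_bigr => v _; rewrite hE.
case: (pselect (f (lpa_one K E) = 1)) => [f1|nf1]; last by exists h; split=> // f1; case: nf1.
(* [h(1)] absorbs [1 = f(1)], the sum of the [f(v)], which complements it to 1. Conjugating by the
   resulting equivalence makes [h] unital. *)
have [a [b [ba ab aZ Zb]]] : equivalent (h (lpa_one K E)) 1.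
  have hh : h (lpa_one K E) * h (lpa_one K E) = h (lpa_one K E) := hom_1l _ _.
  have h0 : h (lpa_one K E) <> 0.
    by rewrite h1E; apply: (sum_neq0 _ _ _ _ _ v0 ST).
  apply: (equivalent_trans (dsum_absorb1 hh h0)).
  rewrite h1E; apply: sum_dsum => //; rewrite -f1 hom_one.
  apply: equivalent_sum => [v _|v w _ _|v w _ _ vw].
  - apply: (equivalent_trans (fq v)).
    exact: (isometries_conj ST (fun (v : vertex E) _ => qq v)).
  - exact: hom_v_orth.
  - exact: (isometries_conj_orth ST).
have lin : linear (fun x => a * h x * b).
  by move=> k x y; rewrite linearP mulrDr mulrDl -scalerAr -scalerAl.
have [x y|h' h'E] := mk_hom lin.
  by rewrite alg_homM !mulrA -(mulrA _ b a) ba -(mulrA a (h x) (h (lpa_one K E))) hom_1r.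
exists h'; split=> [v|_]; last by rewrite h'E aZ ab.
apply: equivalent_trans (hz' v); apply: equivalent_sym; rewrite h'E.
exists (a * h (vx v)), (h (vx v) * b); split.
- by rewrite mulrA -(mulrA _ b) ba hom_1r hom_vE.
- by rewrite mulrA -(mulrA a) hom_vE.
- by rewrite -mulrA hom_vE.
- by rewrite mulrA hom_vE.
Qed.

(** * Absorption and uniqueness up to homotopy *)

(** The doubling homotopy runs on the summand [f] while the summand [h] stays constant. *)
Lemma doubling_homotopic f h (k k' : alg_hom (leavitt K E) B) :
  (forall x, k x = dsum (f x) (h x)) ->
  (forall x, k' x = dsum (dsum (f x) (f x)) (h x)) -> homotopic k k'.
Proof.
move=> kE k'E; have [H [HM H1 H_0 H_1]] := doubling_homotopy BP.
have Hf_lin : linear (fun x => H (f x)) by move=> l x y; rewrite !linearP.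
have [x y|Hf HfE] := mk_hom Hf_lin; first by rewrite alg_homM HM.
have h_lin : linear (fun x => (h x)%:P : poly_alg B).
  by move=> l x y; rewrite linearP polyC_linear.
have [x y|hc hcE] := mk_hom h_lin; first by rewrite alg_homM polyCM.
have [||||G GE] := @orthogonal_sum_hom K _ (poly_alg B) x1%:P x2%:P y1%:P y2%:P
    Hf hc.
- by rewrite -[LHS]polyCM LE.
- by rewrite -[LHS]polyCM LE.
- by rewrite -[LHS]polyCM LE.
- by rewrite -[LHS]polyCM LE.
apply: rst_step; exists G => x; rewrite GE HfE hcE kE k'E.
by rewrite !hornerP H_0 H_1.
Qed.

Lemma standard_homotopic (v0 : vertex E) f g :
  (forall v : vertex E, f (vx v) <> 0) ->
  (forall v : vertex E, equivalent (g (vx v)) 1) ->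
  (f (lpa_one K E) = 1 <-> g (lpa_one K E) = 1) -> homotopic f g.
Proof.
move=> f0 g1 fg1.
(* [h] has to be unital exactly when [f] is; for nonunital [f] a corner copy ensures this. *)
have [h [hE h1]] : exists h,
    (forall v : vertex E, equivalent (h (vx v)) (1 - x1 * f (vx v) * y1)) /\
    (f (lpa_one K E) = 1 <-> h (lpa_one K E) = 1).
  have [h [hE h1]] := complement_hom v0 f.
  case: (pselect (f (lpa_one K E) = 1)) => f1.
    by exists h; split=> //; split=> // _; apply: h1.
  have [h' h'E] := corner_copy h; exists h'; split=> [v|].
    rewrite h'E; apply: equivalent_trans (hE v).
    exact/equivalent_sym/dsum_conjl/hom_vE.
  by rewrite h'E; split=> // /corner_neq1.
have [ff ffE] := dsum_hom f f; have [fh fhE] := dsum_hom f h.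
have [ffh ffhE] := dsum_hom ff h.
have fhv (v : vertex E) : equivalent (dsum (f (vx v)) (h (vx v))) 1.
  have ff' := hom_vE f v; have hh := hom_vE h v.
  pose q := x1 * f (vx v) * y1.
  have qq : q * q = q by rewrite /q !mulrA LE -(mulrA x1) ff'.
  have fq : equivalent (f (vx v)) q by apply: dsum_conjl.
  exact: (equivalent_trans (equivalent_dsum fq (hE v)) (dsum_complement qq)).
(* At each vertex [f] absorbs 1, which is equivalent to the block sum of [f] and [h]. *)
apply: (@homotopic_trans _ _ _ ffh).
  apply: equivalent_vertices_homotopic => [v|].
    rewrite ffhE ffE; have ff' := hom_vE f v; have hh := hom_vE h v.
    apply: (equivalent_trans (dsum_absorb1 ff' (f0 v))).
    apply: (equivalent_trans _ (dsumA ff' ff' hh)).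
    exact: (equivalent_dsum (equivalent_refl ff') (equivalent_sym (fhv v))).
  rewrite ffhE ffE !dsum_eq1; split=> [f1|[[f1 _] _] //].
  by split=> //; apply/h1.
apply: (@homotopic_trans _ _ _ fh).
  apply: homotopic_sym; apply: (doubling_homotopic fhE) => x.
  by rewrite ffhE ffE.
apply: equivalent_vertices_homotopic => [v|].
  rewrite fhE; apply: (equivalent_trans (fhv v)).
  exact/equivalent_sym/g1.
rewrite fhE dsum_eq1; split=> [[f1 _]|g1'].
  exact/fg1.
have f1 : f (lpa_one K E) = 1 by apply/fg1.
by split=> //; apply/h1.
Qed.

(** The isomorphism [F] from [B] to [M_2(B)], with entries [Y i * b * X j], sends [x1 b y1] to the
    corner of [b]. *)
Lemma M2_homotopic_corner f g f' g' :
  (forall x, f' x = x1 * f x * y1) -> (forall x, g' x = x1 * g x * y1) ->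
  homotopic f' g' -> M2_homotopic f g.
Proof.
move=> f'E g'E.
pose X (i : 'I_2) := if i == 0 then x1 else x2.
pose Y (i : 'I_2) := if i == 0 then y1 else y2.
pose F b : mx2_alg B := \matrix_(i, j) (Y i * b * X j).
have lin : linear F.
  move=> k b c; apply/matrixP => i j.
  rewrite [RHS]mxE [X in _ = X + _]mx2_alg_scaleE !mxE.
  by rewrite mulrDr mulrDl -scalerAr -scalerAl.
pose L0 := GRing.isLinear.Build K B (mx2_alg B) *:%R F lin.
pose L : {linear B -> mx2_alg B} := HB.pack F L0.
have LM b c : L (b * c) = L b * L c.
  apply/matrixP => i j; rewrite [RHS]mxE big_ord_recl big_ord1 !mxE /=.
  transitivity (Y i * (b * (x1 * y1 + x2 * y2) * c) * X j).
    by rewrite (x1y1x2y2 BP) mulr1.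
  by rewrite mulrDr mulrDl mulrDr mulrDl !mulrA.
apply: (homotopic_post (th := L)) => // x; apply/matrixP => i j.
  rewrite !mxE f'E /X /Y.
  by case: (i == 0); case: (j == 0); rewrite /= !mulrA !LE.
rewrite !mxE g'E /X /Y.
by case: (i == 0); case: (j == 0); rewrite /= !mulrA !LE.
Qed.

Hypothesis simpleE : simple_algebra (leavitt K E).

Lemma simple_vertex : exists v : vertex E, True.
Proof.
have [[x [y xy]] _] := simpleE.
case: (pickP (@predT (vertex E))) => [v|noV]; first by exists v.
case: xy; have z1 : lpa_one K E = 0 by rewrite /lpa_one big_pred0.
by rewrite -((lpa_oneP x).1) z1 !nu0mul.
Qed.

(** The kernel of a nonzero [f] is zero by simplicity, so [f(v) = 0] would make the vertex itself
    zero in L(E). But [standard_hom] sends it to an idempotent equivalent to 1. *)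
Lemma vertex_neq0 f (v : vertex E) : ~ (forall x, f x = 0) -> f (vx v) <> 0.
Proof.
move=> f0 fv0; have [_ /(_ (fun x => f x = 0))[]] := simpleE.
- split.
  + exact: linear0.
  + by move=> x y fx fy; rewrite linearD fx fy addr0.
  + by move=> k x fx; rewrite linearZ /= fx scaler0.
  + by move=> a x fx; rewrite alg_homM fx mulr0.
  + by move=> a x fx; rewrite alg_homM fx mul0r.
- move=> ker0; have vx0 : vx v = 0 by have : [set 0] (vx v) by rewrite -ker0.
  have [g [gv _]] := standard_hom v.
  apply: (equivalent_neq0 (equivalent_sym (gv v)) one_neq0_prop).
  by rewrite vx0 linear0.
- move=> kerT; apply: f0 => x.
  by have : [set: leavitt K E] x by []; rewrite -kerT.
Qed.

(** Unital homomorphisms are compared with the standard one, nonunital ones with its corner copy. *)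
Lemma nonzero_homotopic f g :
  ~ (forall x, f x = 0) -> ~ (forall x, g x = 0) ->
  (f (lpa_one K E) = 1 <-> g (lpa_one K E) = 1) -> homotopic f g.
Proof.
move=> f0 g0 fg1; have [v0 _] := simple_vertex.
have [s [sv s1]] := standard_hom v0.
have std f' g' : ~ (forall x, f' x = 0) -> (forall v : vertex E, equivalent (g' (vx v)) 1) ->
    (f' (lpa_one K E) = 1 <-> g' (lpa_one K E) = 1) -> homotopic f' g'.
  by move=> f'0; apply: standard_homotopic => // v; apply: vertex_neq0.
case: (pselect (f (lpa_one K E) = 1)) => [f1|f1].
  have g1 := fg1.1 f1.
  by apply: (@homotopic_trans _ _ _ s); [|apply: homotopic_sym]; apply: std.
have g1 : g (lpa_one K E) <> 1 by move/fg1.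
have [t tE] := corner_copy s.
have t1 : t (lpa_one K E) <> 1 by rewrite tE; apply: corner_neq1.
have tv (v : vertex E) : equivalent (t (vx v)) 1.
  apply: equivalent_trans (sv v); rewrite tE.
  exact/equivalent_sym/dsum_conjl/hom_vE.
by apply: (@homotopic_trans _ _ _ t); [|apply: homotopic_sym]; apply: std.
Qed.

Lemma unital_homE f : unital_hom f <-> f (lpa_one K E) = 1.
Proof.
split=> [[u uP fu]|f1]; last by exists (lpa_one K E) => //; apply: lpa_oneP.
by rewrite -fu -((uP (lpa_one K E)).1) ((lpa_oneP u).2).
Qed.

Lemma unital_neq0 f : f (lpa_one K E) = 1 -> ~ (forall x, f x = 0).
Proof. by move=> f1 f0; apply: one_neq0_prop; rewrite -f1 f0. Qed.

(** The corner copies of [f] and [g] are both nonunital, so the condition on units holds for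
    them. *)
Lemma nonzero_M2_homotopic f g :
  ~ (forall x, f x = 0) -> ~ (forall x, g x = 0) -> M2_homotopic f g.
Proof.
move=> f0 g0; have [f' f'E] := corner_copy f; have [g' g'E] := corner_copy g.
apply: (M2_homotopic_corner f'E g'E); apply: nonzero_homotopic.
- move=> f'0; apply: f0 => x; have := congr1 (fun b => y1 * b * x1) (f'0 x).
  by rewrite /= f'E !mulrA !LE.
- move=> g'0; apply: g0 => x; have := congr1 (fun b => y1 * b * x1) (g'0 x).
  by rewrite /= g'E !mulrA !LE.
- by rewrite f'E g'E; split=> /corner_neq1.
Qed.

(** Both sets consist of the class of one unital homomorphism [s], and this class is not 0 because
    only the zero homomorphism is M_2-homotopic to 0. *)
Theorem leavitt_hom_classes :
  set_bij (hset1 (leavitt K E) B) (M2set_nonzero (leavitt K E) B)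
    (to_M2set (leavitt K E) B) /\
  (exists F, hset1 (leavitt K E) B = [set F]) /\
  (exists F, M2set_nonzero (leavitt K E) B = [set F]).
Proof.
have [v0 _] := simple_vertex; have [s [_ s1]] := standard_hom v0.
have hE : hset1 (leavitt K E) B = [set hclass s].
  apply/seteqP; split=> [_ [f /unital_homE f1 <-]|_ ->]; last first.
    by exists s => //; apply/unital_homE.
  have fs : homotopic f s.
    by apply: nonzero_homotopic; [apply: unital_neq0..|rewrite f1 s1].
  apply/seteqP; split=> g; first by apply: homotopic_trans; apply: homotopic_sym.
  exact: homotopic_trans.
have M2E f g : M2_homotopic f g -> M2class f = M2class g.
  move=> fg; apply/seteqP; split=> h; last exact: homotopic_trans.
  by apply: homotopic_trans; apply: homotopic_sym.
have ME : M2set_nonzero (leavitt K E) B = [set M2class s].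
  apply/seteqP; split=> [_ [[f _ <-] nz]|_ ->].
    apply/M2E/nonzero_M2_homotopic; last exact: unital_neq0.
    by move=> f0; apply: nz; apply: M2E; apply: homotopic_ext => x /=; rewrite f0.
  split; first by exists s.
  move=> s0; apply: (unital_neq0 s1); apply: M2_homotopic_zero.
  by rewrite -[M2_homotopic _ s]/(M2class (zero_hom (leavitt K E) B) s) -s0; apply: rst_refl.
split; last by split; [exists (hclass s)|exists (M2class s)].
rewrite hE ME; split.
- by move=> _ ->; rewrite /= to_M2setE.
- by move=> c d; rewrite !inE => -> ->.
- by move=> _ ->; exists (hclass s) => //; apply: to_M2setE.
Qed.

End Graph.
End Target.

(** * L_2 and R (x) L_2 absorb L_2 *)

Section LeavittRelations.
Import GRing.Theory.
Local Open Scope ring_scope.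
Variables (K : fieldType) (B : algType K) (x1 x2 y1 y2 : B).
Hypotheses (y1x1 : y1 * x1 = 1) (y1x2 : y1 * x2 = 0).
Hypotheses (y2x1 : y2 * x1 = 0) (y2x2 : y2 * x2 = 1).
Hypothesis xy1 : x1 * y1 + x2 * y2 = 1.

Let right_cancel (a b : B) (ab : a * b = 1) c : c * a * b = c.
Proof. by rewrite -mulrA ab mulr1. Qed.
Let right_kill (a b : B) (ab : a * b = 0) c : c * a * b = 0.
Proof. by rewrite -mulrA ab mulr0. Qed.
Let LE := (y1x1, y1x2, y2x1, y2x2, right_cancel y1x1, right_cancel y2x2,
  right_kill y1x2, right_kill y2x1, mul0r, mulr0, mul1r, mulr1).

Local Notation double b := (x1 * b * y1 + x2 * b * y2).

(* With words m = x1 x2 and n = x2 x1 the flip exchanges m and n; it is the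
   product of the rotation m -> n -> -m with the square of a rotation of n x1
   and n x2, which is -1 on n. *)
Lemma flip_connected : exists T T', [/\ connected 1 T T',
  T * x1 = double x1 & T * x2 = double x2].
Proof.
have [||||R [R' [RR Rm Rn _ Rz]]] :=
  @rotation K B (x1 * x2) (y2 * y1) (x2 * x1) (y1 * y2); rewrite ?mulrA ?LE //.
have [||||S [S' [SS Sm Sn _ Sz]]] := @rotation K B (x2 * x1 * x1) (y1 * y1 * y2)
  (x2 * x1 * x2) (y2 * y1 * y2); rewrite ?mulrA ?LE //.
have split (z : B) : z = z * x1 * y1 + z * x2 * y2.
  by rewrite -!mulrA -mulrDr xy1 mulr1.
have S2n : S * (S * (x2 * x1)) = - (x2 * x1).
  have -> : S * (x2 * x1) = x2 * x1 * x2 * y1 - x2 * x1 * x1 * y2.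
    by rewrite {1}(split (x2 * x1)) mulrDr (mulrA S (x2 * x1 * x1)) (mulrA S (x2 * x1 * x2))
      Sm Sn mulNr.
  rewrite mulrBr (mulrA S (x2 * x1 * x1)) (mulrA S (x2 * x1 * x2)) Sm Sn.
  rewrite mulNr -opprD.
  by rewrite [in RHS](split (x2 * x1)).
have Tz z : y1 * y1 * y2 * z = 0 -> y2 * y1 * y2 * z = 0 ->
    R * (S * S) * z = R * z.
  by move=> z1 z2; rewrite -!mulrA !Sz.
exists (R * (S * S)), ((S' * S') * R'); split.
- exact: connectedM RR (connectedM SS SS).
(* Splitting [x1] as [x1 x1 y1 + x1 x2 y2] reduces the claim to words of length two. *)
- have T11 : R * (S * S) * (x1 * x1) = x1 * x1.
    by rewrite Tz ?Rz ?mulrA ?LE.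
  have T12 : R * (S * S) * (x1 * x2) = x2 * x1.
    by rewrite Tz ?mulrA ?LE // -Rm !mulrA.
  by rewrite {1}(split x1) mulrDr (mulrA _ (x1 * x1)) (mulrA _ (x1 * x2)) T11 T12.
- have T21 : R * (S * S) * (x2 * x1) = x1 * x2.
    by rewrite -!mulrA S2n mulrN Rn opprK.
  have T22 : R * (S * S) * (x2 * x2) = x2 * x2.
    by rewrite Tz ?Rz ?mulrA ?LE.
  by rewrite {1}(split x2) mulrDr (mulrA _ (x2 * x1)) (mulrA _ (x2 * x2)) T21 T22.
Qed.

(* Cuntz's argument.  Multiplying b <> 0 on the right by a long word leaves a
   nonzero polynomial in x1, x2 with coefficients in S; removing a leading word
   makes its constant term c nonzero, and compressing by x1^M x2 with M large
   leaves c. *)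
Section TwoSidedInverse.
(** The coefficients: the scalars in L_2, and the elements r (x) 1 in R (x) L_2. *)
Variable S : B -> Prop.
Hypotheses (S0 : S 0) (S1 : S 1).
Hypothesis SD : forall c d, S c -> S d -> S (c + d).
Hypothesis SM : forall c d, S c -> S d -> S (c * d).
Hypotheses (Sx1 : forall c, S c -> c * x1 = x1 * c)
           (Sx2 : forall c, S c -> c * x2 = x2 * c)
           (Sy1 : forall c, S c -> c * y1 = y1 * c)
           (Sy2 : forall c, S c -> c * y2 = y2 * c).
Hypothesis Sinv : forall c, S c -> c <> 0 -> exists a b, a * c * b = 1.
Hypothesis gen_ind : forall Q : B -> Prop,
  (forall c, S c -> Q c) -> Q x1 -> Q x2 -> Q y1 -> Q y2 ->
  (forall a b, Q a -> Q b -> Q (a + b)) ->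
  (forall a b, Q a -> Q b -> Q (a * b)) -> forall b, Q b.

(** Noncommutative polynomials of degree at most [n] in [x1], [x2] over [S], in a form exposing the
    leading letter. *)
Fixpoint positive_part (n : nat) (a : B) : Prop :=
  if n is n'.+1 then
    exists c a1 a2, [/\ S c, positive_part n' a1, positive_part n' a2 &
      a = c + x1 * a1 + x2 * a2]
  else S a.
Local Notation PP := positive_part.

Fixpoint word (s : seq bool) : B :=
  if s is b :: s' then (if b then x2 else x1) * word s' else 1.

Lemma word_cat s t : word (s ++ t) = word s * word t.
Proof. by elim: s => [|b s IH] /=; rewrite ?mul1r // IH mulrA. Qed.

Lemma word_comm c s : S c -> c * word s = word s * c.
Proof.
move=> Sc; elim: s => [|b s IH] /=; first by rewrite mulr1 mul1r.
rewrite mulrA (_ : c * _ = (if b then x2 else x1) * c) -?mulrA ?IH //.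
by case: b; [apply: Sx2 | apply: Sx1].
Qed.

Lemma positive_part0 n : PP n 0.
Proof.
elim: n => //= n IH; exists 0, 0, 0; split=> //.
by rewrite !mulr0 !addr0.
Qed.

Lemma positive_part_const n c : S c -> PP n c.
Proof.
case: n => //= n Sc; exists c, 0, 0; split=> //; try exact: positive_part0.
by rewrite !mulr0 !addr0.
Qed.

Lemma positive_partW n a : PP n a -> PP n.+1 a.
Proof.
elim: n a => [|n IH] a; first exact: (@positive_part_const 1).
by case=> c [a1 [a2 [Sc P1 P2 ->]]]; exists c, a1, a2; split=> //; apply: IH.
Qed.

Lemma positive_part_le n m a : (n <= m)%N -> PP n a -> PP m a.
Proof.
by move=> /subnK <-; elim: (m - n)%N => // k IH /IH; apply: positive_partW.
Qed.

Lemma positive_partD n a b : PP n a -> PP n b -> PP n (a + b).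
Proof.
elim: n a b => [|n IH] a b; first exact: SD.
move=> [c [a1 [a2 [Sc A1 A2 ->]]]] [d [b1 [b2 [Sd B1 B2 ->]]]].
exists (c + d), (a1 + b1), (a2 + b2); split; [exact: SD|exact: IH|exact: IH|].
by rewrite !mulrDr addrACA (addrACA c).
Qed.

Lemma positive_part_x1 n a : PP n a -> PP n.+1 (x1 * a).
Proof.
move=> Pa; exists 0, a, 0; split=> //; first exact: positive_part0.
by rewrite mulr0 addr0 add0r.
Qed.

Lemma positive_part_x2 n a : PP n a -> PP n.+1 (x2 * a).
Proof.
move=> Pa; exists 0, 0, a; split=> //; first exact: positive_part0.
by rewrite mulr0 addr0 add0r.
Qed.

Lemma positive_partMr n a c : S c -> PP n a -> PP n (a * c).
Proof.
move=> Sc; elim: n a => [|n IH] a; first by move=> Sa; apply: SM.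
move=> [d [a1 [a2 [Sd P1 P2 ->]]]]; exists (d * c), (a1 * c), (a2 * c).
by split; [exact: SM|exact: IH|exact: IH|rewrite !mulrDl !mulrA].
Qed.

Definition eventually_positive (b : B) (N : nat) : Prop :=
  forall s, (N <= size s)%N -> exists n, PP n (b * word s).

Lemma word_positive s : PP (size s) (word s).
Proof.
by elim: s => //= -[] s IH; [apply: positive_part_x2 | apply: positive_part_x1].
Qed.

(** Induction on the degree of [a]. A leading letter of [a] is moved into [b], where it lengthens
    the word; the bound [N] is therefore kept. *)
Lemma eventually_positive_mul b N n a : eventually_positive b N -> PP n a ->
  eventually_positive (b * a) N.
Proof.
elim: n b a => [|n IH] b a bP.
  move=> Sa s /bP[m Pm]; exists m.
  by rewrite -mulrA word_comm // mulrA; apply: positive_partMr.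
move=> [c [a1 [a2 [Sc P1 P2 ->]]]] s Ns.
have [m Pm] := bP s Ns.
have [m1 Pm1] : exists m, PP m (b * x1 * a1 * word s).
  apply: (IH (b * x1) a1) => // t Nt.
  by have := bP (false :: t) (leqW Nt); rewrite /= mulrA.
have [m2 Pm2] : exists m, PP m (b * x2 * a2 * word s).
  apply: (IH (b * x2) a2) => // t Nt.
  by have := bP (true :: t) (leqW Nt); rewrite /= mulrA.
exists (maxn m (maxn m1 m2)); rewrite !mulrDr !mulrDl !mulrA.
apply: positive_partD; first apply: positive_partD.
- rewrite -mulrA word_comm // mulrA; apply: positive_partMr => //.
  by apply: positive_part_le Pm; rewrite leq_maxl.
- by apply: positive_part_le Pm1; rewrite leq_max leq_maxl orbT.
- by apply: positive_part_le Pm2; rewrite leq_max leq_maxr orbT.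
Qed.

Lemma exists_eventually_positive b : exists N, eventually_positive b N.
Proof.
elim/gen_ind: b => [c Sc|||||a b [N aP] [M bP]|a b [N aP] [M bP]].
- exists 0%N => s _; exists (size s); rewrite word_comm //.
  exact/positive_partMr/word_positive.
- by exists 0%N => s _; exists (size s).+1; apply/positive_part_x1/word_positive.
- by exists 0%N => s _; exists (size s).+1; apply/positive_part_x2/word_positive.
- exists 1%N => -[|[] s] // _ /=; rewrite mulrA LE.
    by exists 0%N; rewrite mul0r.
  by exists (size s); rewrite mul1r; apply: word_positive.
- exists 1%N => -[|[] s] // _ /=; rewrite mulrA LE.
    by exists (size s); rewrite mul1r; apply: word_positive.
  by exists 0%N; rewrite mul0r.
- exists (maxn N M) => s; rewrite geq_max => /andP[/aP[n Pn] /bP[m Pm]].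
  exists (maxn n m); rewrite mulrDl; apply: positive_partD.
    by apply: positive_part_le Pn; apply: leq_maxl.
  by apply: positive_part_le Pm; apply: leq_maxr.
(* The first [M] letters make [b] positive, and the at least [N] remaining ones serve for [a]. *)
- exists (M + N)%N => s Ns; rewrite -(cat_take_drop M s) word_cat !mulrA.
  have [n Pn] : exists n, PP n (b * word (take M s)).
    apply: bP; rewrite size_take; case: ltnP => // sM.
    by apply: leq_trans Ns; apply: leq_addr.
  rewrite -(mulrA a); apply: (eventually_positive_mul aP Pn).
  by rewrite size_drop leq_subRL // (leq_trans (leq_addr _ _) Ns).
Qed.

Lemma word_neq0 b N : b <> 0 -> exists2 s, size s = N & b * word s <> 0.
Proof.
elim: N b => [|N IH] b b0; first by exists [::]; rewrite //= mulr1.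
case: (pselect (b * x1 = 0)) => [bx1|/IH[s sN bs]]; last first.
  by exists (false :: s); rewrite /= ?sN // mulrA.
case: (pselect (b * x2 = 0)) => [bx2|/IH[s sN bs]]; last first.
  by exists (true :: s); rewrite /= ?sN // mulrA.
by case: b0; rewrite -[b]mulr1 -xy1 mulrDr !mulrA bx1 bx2 !mul0r addr0.
Qed.

(** When the constant term is zero, [y1] or [y2] strips a leading letter and leaves a nonzero
    element of smaller degree. *)
Lemma nonzero_constant n a : PP n a -> a <> 0 -> exists d c m a1 a2,
  [/\ S c, c <> 0, PP m a1, PP m a2 & d * a = c + x1 * a1 + x2 * a2].
Proof.
elim: n a => [|n IH] a.
  move=> Sa a0; exists 1, a, 0%N, 0, 0; split=> //.
  by rewrite mul1r !mulr0 !addr0.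
move=> [c [a1 [a2 [Sc P1 P2 ->]]]] a0.
case: (pselect (c = 0)) => [c0|c0]; last first.
  by exists 1, c, n, a1, a2; rewrite mul1r.
case: (pselect (a1 = 0)) => [a10|/(IH _ P1)[d [e [m [b1 [b2 [? ? ? ? dE]]]]]]].
  case: (pselect (a2 = 0)) => [a20|/(IH _ P2)[d [e [m [b1 [b2 [? ? ? ? dE]]]]]]].
    by case: a0; rewrite c0 a10 a20 !mulr0 !addr0.
  exists (d * y2), e, m, b1, b2; split=> //.
  by rewrite c0 add0r mulrDr !mulrA !LE add0r.
exists (d * y1), e, m, b1, b2; split=> //.
by rewrite c0 add0r mulrDr !mulrA !LE addr0.
Qed.

(** A word of length at most [k] containing [x2] is killed by [y1^k]. A power of [x1] leaves a
    positive power of [x1] on the right because [k < l], and [y2] kills it. *)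
Lemma compress_positive n a k l : PP n a -> (n <= k)%N -> (k < l)%N ->
  y2 * y1 ^+ k * a * x1 ^+ l * x2 = 0.
Proof.
have yx k' l' : (k' < l')%N -> y2 * y1 ^+ k' * x1 ^+ l' = 0.
  elim: k' l' => [|k' IH] [|l'] //; first by rewrite expr0 mulr1 exprS mulrA !LE.
  by rewrite ltnS => /IH; rewrite exprSr exprS !mulrA LE.
have yk c k' : S c -> y2 * y1 ^+ k' * c = c * (y2 * y1 ^+ k').
  move=> Sc; rewrite mulrA Sy2 // -!mulrA; congr (_ * _).
  by elim: k' => [|k' IH]; rewrite ?expr0 ?mul1r ?mulr1 // exprS -mulrA IH
    !mulrA Sy1.
elim: n a k l => [|n IH] a k l.
  by move=> Sa _ kl; rewrite yk // -(mulrA a) yx // mulr0 mul0r.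
move=> [c [a1 [a2 [Sc P1 P2 ->]]]]; case: k => // k nk kl.
rewrite !mulrDr !mulrDl yk // -(mulrA c) yx // mulr0 mul0r add0r.
rewrite exprSr !mulrA !LE addr0; case: l kl => // l kl.
by apply: IH => //; apply: ltnW.
Qed.

Lemma two_sided_inverse (b : B) : b <> 0 -> exists a c, a * b * c = 1.
Proof.
move=> b0; have [N bP] := exists_eventually_positive b.
have [s sN bs] := word_neq0 N b0.
have [n Pn] := bP s (eq_leq (esym sN)).
have [d [c [m [a1 [a2 [Sc c0 P1 P2 dE]]]]]] := nonzero_constant Pn bs.
have [f [g fcg]] := Sinv Sc c0.
have yx k : y1 ^+ k * x1 ^+ k = 1.
  elim: k => [|k IH]; first by rewrite mulr1.
  by rewrite exprSr exprS mulrA -(mulrA _ y1) y1x1 mulr1.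
(* With exponent [m + 1] the constant term survives. The letter [x2] is killed at once, and [x1]
   uses up one [y1], leaving [m < m + 1] for [compress_positive]. *)
have gP : y2 * y1 ^+ m.+1 * (d * (b * word s)) * (x1 ^+ m.+1 * x2) = c.
  rewrite dE !mulrA !mulrDr !mulrDl.
  have -> : y2 * y1 ^+ m.+1 * (x1 * a1) * x1 ^+ m.+1 * x2 = 0.
    by rewrite exprSr !mulrA LE (compress_positive P1).
  have -> : y2 * y1 ^+ m.+1 * (x2 * a2) * x1 ^+ m.+1 * x2 = 0.
    by rewrite exprSr !mulrA !LE.
  have cx : c * (x1 ^+ m.+1 * x2) = x1 ^+ m.+1 * x2 * c.
    have := word_comm (nseq m.+1 false ++ [:: true]) Sc; rewrite word_cat /= mulr1.
    have -> : word (nseq m false) = x1 ^+ m.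
      by elim: (m) => //= k ->; rewrite exprS.
    by rewrite -exprS.
  rewrite !addr0 -2!mulrA cx !mulrA -(mulrA y2) yx mulr1 y2x2 mul1r //.
exists (f * (y2 * y1 ^+ m.+1 * d)), (word s * (x1 ^+ m.+1 * x2) * g).
by rewrite -fcg -gP !mulrA.
Qed.

End TwoSidedInverse.

End LeavittRelations.

(** * Verification for L_2 and for R (x) L_2 *)

Section Instances.
Import GRing.Theory.
Local Open Scope ring_scope.
Variable K : fieldType.

Local Notation L2gen := (gen (@lpa_rel K rose2)).
Definition loop (b : bool) : L2 K := L2gen (@Edg rose2 b).
Definition ghost (b : bool) : L2 K := L2gen (@Gho rose2 b).

Lemma L2_vertex : L2gen (@Vtx rose2 tt) = 1 :> L2 K.
Proof.
by rewrite -[1]/(lpa_one K rose2) /lpa_one (bigD1 tt) //= big1 ?addr0 // => -[].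
Qed.

(** The identity is viewed as a homomorphism into the unital algebra, so that the lemmas on
    homomorphisms give the relations of L_2. *)
Lemma L2_id_hom :
  exists f : alg_hom (leavitt K rose2) (L2 K), forall x, f x = x.
Proof. exact: (@mk_hom K (leavitt K rose2) (L2 K) id). Qed.

Lemma ghost_loop b b' : ghost b * loop b' = (b == b')%:R.
Proof.
have [f fE] := L2_id_hom; have := hom_ck1 f b b'; rewrite !fE => ->.
by case: eqP => // _; rewrite L2_vertex.
Qed.

Lemma loop_ghost : loop false * ghost false + loop true * ghost true = 1.
Proof.
have [f fE] := L2_id_hom; have := @hom_ck2 K rose2 (L2 K) f tt.
rewrite fE L2_vertex => -> //; last by exists true.
by rewrite (eq_bigl xpredT) // big_bool addrC !fE.
Qed.

Lemma L2_ind (Q : L2 K -> Prop) :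
  (forall k : K, Q (k%:A)) -> (forall b, Q (loop b)) -> (forall b, Q (ghost b)) ->
  (forall a b, Q a -> Q b -> Q (a + b)) ->
  (forall a b, Q a -> Q b -> Q (a * b)) -> forall x, Q x.
Proof.
move=> QS Ql Qg QD QM; elim/presW.
elim=> [[[]|b|b]||s IHs t IHt|k s IHs|s IHs t IHt].
- by have := QS 1; rewrite scale1r -L2_vertex.
- exact: Ql.
- exact: Qg.
- by have := QS 0; rewrite scale0r.
- by rewrite cls_add; apply: QD.
- have -> : cls (@lpa_rel K rose2) (TScale k s) =
      (k%:A : L2 K) * (cls (@lpa_rel K rose2) s : L2 K).
    by rewrite mulr_algl; apply: cls_scale.
  exact: QM.
- by rewrite cls_mul; apply: QM.
Qed.

(** Let [U] be the path from 1 to the flip. The loops are multiplied by [U] on the left, the ghosts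
    by its inverse on the right; the flip times a loop is that loop doubled. *)
Lemma L2_doubling : exists H : {linear L2 K -> poly_alg (L2 K)},
  [/\ forall a b, H (a * b) = H a * H b, H 1 = 1,
      forall b, (H b : {poly L2 K}).[0] = b &
      forall b, (H b : {poly L2 K}).[1] =
        loop false * b * ghost false + loop true * b * ghost true].
Proof.
have [T [T' [[U [U' [[UU' U'U _ _] U0 U1 U'1]]] T1 T2]]] :=
  flip_connected (ghost_loop false false) (ghost_loop false true)
    (ghost_loop true false) (ghost_loop true true) loop_ghost.
have U'0 : U'.[0] = 1.
  have := congr1 (fun P : {poly L2 K} => P.[0]) UU'.
  by rewrite !hornerP U0 mul1r.
have [| | | | |b b'|v _|H [Hv He Hg]] :=
    @leavitt_family K rose2 (poly_alg (L2 K)) (fun=> 1)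
      (fun b => U * (loop b)%:P) (fun b => (ghost b)%:P * U').
- by move=> [] []; rewrite mulr1.
- by move=> e; rewrite mul1r.
- by move=> e; rewrite mulr1.
- by move=> e; rewrite mul1r.
- by move=> e; rewrite mulr1.
- rewrite -[LHS]/((ghost b)%:P * U' * (U * (loop b')%:P)) mulrA -(mulrA _ U').
  by rewrite U'U mulr1 -polyCM ghost_loop; case: eqP.
- case: v; rewrite (eq_bigl xpredT) // big_bool.
  rewrite -[RHS]/(U * (loop true)%:P * ((ghost true)%:P * U') +
    U * (loop false)%:P * ((ghost false)%:P * U')).
  rewrite !mulrA -!(mulrA U) -!polyCM -mulrDr -mulrDl -polyCD addrC loop_ghost.
  by rewrite mul1r UU'.
have [h0 h0E] := eval_hom H false; have [h1 h1E] := eval_hom H true.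
have [f fE] := L2_id_hom.
have [||||g gE] := orthogonal_sum_hom (x1 := loop false) (x2 := loop true)
  (y1 := ghost false) (y2 := ghost true) f f; rewrite ?ghost_loop //.
have UT : U.[1] * U'.[1] = 1.
  by have := congr1 (fun P : {poly L2 K} => P.[1]) UU'; rewrite !hornerP.
have Hloop b : U.[1] * loop b = g (loop b).
  by rewrite gE !fE U1; case: b; [exact: T2 | exact: T1].
(* The ghosts are determined by the loops: [g (ghost b)] times the flip is [ghost b], as one checks
   after multiplying by the loops. *)
have Hghost b : ghost b * U'.[1] = g (ghost b).
  have gg b1 b2 : g (ghost b1) * g (loop b2) = (b1 == b2)%:R.
    rewrite [LHS](hom_ck1 g b1 b2) gE fE L2_vertex !mulr1 loop_ghost.
    by case: eqP.
  have gU : g (ghost b) * U.[1] = ghost b.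
    have -> : U.[1] =
        U.[1] * loop false * ghost false + U.[1] * loop true * ghost true.
      by rewrite -!mulrA -mulrDr loop_ghost mulr1.
    rewrite !Hloop mulrDr !mulrA !gg.
    by case: b; rewrite ?mul0r ?mul1r ?addr0 ?add0r.
  by rewrite -{1}gU -mulrA UT mulr1.
exists H; split.
- exact: alg_homM.
- by have := Hv tt; rewrite L2_vertex.
- move=> b; rewrite -[RHS]fE -[LHS]h0E; apply: leavitt_ext => [[]|e|e].
  + by rewrite h0E Hv fE hornerP L2_vertex.
  + by rewrite h0E He fE !hornerP U0 mul1r.
  + by rewrite h0E Hg fE !hornerP U'0 mulr1.
- move=> b; rewrite -[RHS]/(loop false * b * ghost false + _).
  rewrite -[b in RHS]fE -gE -[LHS]h1E; apply: leavitt_ext => [[]|e|e].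
  + by rewrite h1E Hv gE fE L2_vertex !mulr1 loop_ghost hornerP.
  + by rewrite h1E He !hornerP; apply: Hloop.
  + by rewrite h1E Hg !hornerP; apply: Hghost.
Qed.

Lemma L2_absorbs : absorbs_L2 (loop false) (loop true) (ghost false) (ghost true).
Proof.
split; rewrite ?ghost_loop ?loop_ghost //; last exact: L2_doubling.
have comm (c b : L2 K) : (exists k : K, c = k%:A) -> c * b = b * c.
  by move=> [k ->]; rewrite mulr_algl mulr_algr.
apply: (@two_sided_inverse K (L2 K) _ _ _ _ (ghost_loop false false)
  (ghost_loop false true) (ghost_loop true false) (ghost_loop true true)
  loop_ghost (fun c => exists k : K, c = k%:A)) => //.
- by exists 0; rewrite scale0r.
- by exists 1; rewrite scale1r.
- by move=> _ _ [k ->] [l ->]; exists (k + l); rewrite scalerDl.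
- by move=> _ _ [k ->] [l ->]; exists (k * l); rewrite mulr_algl scalerA.
- by move=> c; apply: comm.
- by move=> c; apply: comm.
- by move=> c; apply: comm.
- by move=> c; apply: comm.
- move=> _ [k ->] k0; exists (k^-1)%:A, 1.
  rewrite mulr1 mulr_algl scalerA mulVf ?scale1r //.
  by apply/eqP => k00; apply: k0; rewrite k00 scale0r.
- move=> Q QS Q1 Q2 Q3 Q4 QD QM.
  by apply: L2_ind => [k|[]|[]|a b|a b] //; [apply: QS; exists k|apply: QD|apply: QM].
Qed.

Section TensorInstance.
Variable R : algType K.
Local Notation RL2 := (tensorL2 R).
Local Notation tp r z := (@tprod K R (L2 K) r z : RL2).

Lemma tensor_id_hom : exists f : alg_hom (tensor R (L2 K)) RL2, forall x, f x = x.
Proof. exact: (@mk_hom K (tensor R (L2 K)) RL2 id). Qed.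

Lemma tensorL2_tprodM r r' z z' : tp r z * tp r' z' = tp (r * r') (z * z').
Proof. exact: tprodM. Qed.

Lemma tensorL2_tprod10 : tp 1 0 = 0 :> RL2.
Proof. by rewrite -(scale0r (0 : L2 K)) [LHS]tprodZr scale0r. Qed.

Lemma tensor_L2_hom :
  exists f : alg_hom (leavitt K rose2) RL2, forall z, f z = tp 1 z.
Proof.
apply: mk_hom => [k z z'|z z']; first by rewrite [LHS]tprodDr tprodZr.
by rewrite tensorL2_tprodM mul1r.
Qed.

(** The homotopy for L_2 is extended R-linearly: r (x) z goes to r (x) 1 times the image of z. This
    is multiplicative since r (x) 1 commutes with coefficients of the form 1 (x) z. *)
Lemma tensor_doubling : exists H : {linear RL2 -> poly_alg RL2},
  [/\ forall a b, H (a * b) = H a * H b, H 1 = 1,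
      forall b, (H b : {poly RL2}).[0] = b &
      forall b, (H b : {poly RL2}).[1] =
        tp 1 (loop false) * b * tp 1 (ghost false) +
        tp 1 (loop true) * b * tp 1 (ghost true)].
Proof.
have [H0 [H0M H01 H0_0 H0_1]] := L2_doubling.
have [j jE] := tensor_L2_hom.
have [| |H1 H1E] := @mk_hom K (leavitt K rose2) (poly_alg (L2 K)) H0.
- by move=> k x y; rewrite linearP.
- exact: H0M.
have jM (x y : L2 K) : j (x * y) = j x * j y := alg_homM j x y.
have [G [GE G0 G1]] := map_poly_hom (B := L2 K) (th := j) H1 jM.
have comm r z : (tp r 1)%:P * (G z : {poly RL2}) = (G z : {poly RL2}) * (tp r 1)%:P.
  apply/polyP => i; rewrite coefCM coefMC GE coef_map /= jE !tensorL2_tprodM.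
  by rewrite !mul1r !mulr1.
pose phi (p : R * L2 K) : poly_alg RL2 := (tp p.1 1)%:P * (G p.2 : {poly RL2}).
have [_ _ [r r' z|r z z'|k r z|k r z|r r' z z']|H HE] :=
  @presented_lift K _ (@tensor_rel K R (L2 K)) (poly_alg RL2) phi.
- by rewrite /= /phi /= [tprod _ _]tprodDl polyCD; apply: mulrDl.
- by rewrite /= /phi /= linearD; apply: mulrDr.
- rewrite /= /phi /= [tprod _ _]tprodZl polyC_scale.
  by rewrite scalerAl.
- by rewrite /= /phi /= linearZ scalerAr.
- rewrite /= /phi /=.
  rewrite -[LHS]/((tp r 1)%:P * (G z : {poly RL2}) * ((tp r' 1)%:P * (G z' : {poly RL2}))).
  rewrite mulrA -(mulrA (tp r 1)%:P) -comm mulrA -polyCM tensorL2_tprodM mulr1 -mulrA.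
  by congr (_ * _); rewrite -[LHS]/((G z : poly_alg RL2) * G z') -alg_homM.
have [f fE] := tensor_id_hom.
have [h0 h0E] := eval_hom H false; have [h1 h1E] := eval_hom H true.
have [||||g gE] := orthogonal_sum_hom (x1 := tp 1 (loop false))
  (x2 := tp 1 (loop true)) (y1 := tp 1 (ghost false)) (y2 := tp 1 (ghost true)) f f;
  rewrite ?tensorL2_tprodM ?ghost_loop ?mulr1 ?tensorL2_tprod10 //.
exists H; split.
- exact: alg_homM.
- have -> : (1 : RL2) = gen (@tensor_rel K R (L2 K)) (1, 1) by [].
  rewrite HE /phi /= polyC1 mul1r; apply/polyP => i.
  by rewrite GE coef_map /= H1E H01 coef1 -polyC1 coefC; case: eqP; rewrite ?linear0 // jE.
- move=> b; rewrite -[RHS]fE -[LHS]h0E; apply: presented_ext => -[r z].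
  rewrite h0E HE fE /phi /= !hornerP G0 H1E H0_0 jE tensorL2_tprodM mulr1 mul1r //.
- move=> b; rewrite -[RHS]/(tp 1 (loop false) * b * _ + _) -[b in RHS]fE -gE.
  rewrite -[LHS]h1E; apply: presented_ext => -[r z].
  rewrite h1E HE gE fE /phi /= !hornerP G1 H1E H0_1 linearD !jE mulrDr.
  by rewrite -[gen _ _]/(tp r z) !tensorL2_tprodM !mul1r !mulr1.
Qed.

(** Cuntz's argument with coefficients r (x) 1: the hypothesis on R inverts the nonzero coefficient
    that it isolates. *)
Lemma tensor_absorbs : (forall r : R, r <> 0 -> exists a b, a * r * b = 1) ->
  absorbs_L2 (tp 1 (loop false)) (tp 1 (loop true))
             (tp 1 (ghost false)) (tp 1 (ghost true)).
Proof.
move=> Rinv.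
have yx b b' : tp 1 (ghost b) * tp 1 (loop b') = (b == b')%:R.
  by rewrite tensorL2_tprodM mulr1 ghost_loop; case: eqP => // _; rewrite tensorL2_tprod10.
have xy : tp 1 (loop false) * tp 1 (ghost false) +
    tp 1 (loop true) * tp 1 (ghost true) = 1.
  by rewrite !tensorL2_tprodM mulr1 -[LHS]tprodDr loop_ghost.
split; rewrite ?yx ?xy //; last exact: tensor_doubling.
have comm z (c : RL2) : (exists r, c = tp r 1) -> c * tp 1 z = tp 1 z * c.
  by move=> [r ->]; rewrite !tensorL2_tprodM !mul1r !mulr1.
apply: (@two_sided_inverse K RL2 _ _ _ _ (yx false false) (yx false true)
  (yx true false) (yx true true) xy (fun c => exists r, c = tp r 1)) => //.
- by exists 0; rewrite -(scale0r (0 : R)) [RHS]tprodZl scale0r.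
- by exists 1.
- by move=> _ _ [r ->] [s ->]; exists (r + s); rewrite [RHS]tprodDl.
- by move=> _ _ [r ->] [s ->]; exists (r * s); rewrite tensorL2_tprodM mulr1.
- exact: comm.
- exact: comm.
- exact: comm.
- exact: comm.
- move=> _ [r ->] r0; have [r00|a [b arb]] := Rinv r.
    by apply: r0; rewrite r00 -(scale0r (0 : R)) [LHS]tprodZl scale0r.
  by exists (tp a 1), (tp b 1); rewrite !tensorL2_tprodM arb !mulr1.
- move=> Q QS Q1 Q2 Q3 Q4 QD QM.
  have Qz (z : L2 K) : Q (tp 1 z).
    elim/L2_ind: z => [k|[]|[]|a b Qa Qb|a b Qa Qb] //.
    + by apply: QS; exists k%:A; rewrite [LHS]tprodZr [RHS]tprodZl.
    + by rewrite [tprod _ _]tprodDr; apply: QD.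
    + by rewrite -[1]mulr1 -tensorL2_tprodM; apply: QM.
  elim/presW; elim=> [[r z]||s IHs t IHt|k s IHs|s IHs t IHt].
  + rewrite -[cls _ _]/(tp r z) -[r]mulr1 -[z]mul1r -tensorL2_tprodM.
    by apply: QM => //; apply: QS; exists r.
  + by apply: QS; exists 0; rewrite -(scale0r (0 : R)) [RHS]tprodZl scale0r.
  + by rewrite cls_add; apply: QD.
  + have -> : cls (@tensor_rel K R (L2 K)) (TScale k s) =
        tp k%:A 1 * (cls (@tensor_rel K R (L2 K)) s : RL2).
      by rewrite [tprod _ _]tprodZl mulr_algl; apply: cls_scale.
    by apply: QM => //; apply: QS; exists k%:A.
  + by rewrite cls_mul; apply: QM.
Qed.
End TensorInstance.

End Instances.

Theorem theorem1p3 (K : fieldType) (E : finite_graph)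
    (LE_simple : simple_algebra (leavitt K E))
    (R : algType K)
    (R_pis : purely_infinite_simple R)
    (R_rsc : regular_supercoherent R) :
  (set_bij (hset1 (leavitt K E) (L2 K)) (M2set_nonzero (leavitt K E) (L2 K))
     (to_M2set (leavitt K E) (L2 K)) /\
   (exists c, hset1 (leavitt K E) (L2 K) = [set c]) /\
   (exists c, M2set_nonzero (leavitt K E) (L2 K) = [set c])) /\
  (set_bij (hset1 (leavitt K E) (tensorL2 R))
     (M2set_nonzero (leavitt K E) (tensorL2 R))
     (to_M2set (leavitt K E) (tensorL2 R)) /\
   (exists c, hset1 (leavitt K E) (tensorL2 R) = [set c]) /\
   (exists c, M2set_nonzero (leavitt K E) (tensorL2 R) = [set c])).
Proof.
split; first exact: (leavitt_hom_classes (L2_absorbs K) LE_simple).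
exact: (leavitt_hom_classes (tensor_absorbs R_pis.2) LE_simple).
Qed.
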